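(* Consider the source language and CBPV extended with recursion, with the model in $\omega\mathbf{Cpo}$ given by the lifting monad. Then $\mathcal V[\![e]\!]\ltimes\mathcal N[\![e]\!]$ for every source-language expression $\Gamma\vdash e:\tau$, and in particular, for every closed source-language expression $e':\mathbf{bool}$ and every closed CBPV value $V:\mathbf{bool}$, $$\mathcal V(e')\Downarrow\mathbf{return}\,V\quad\Rightarrow\quad\mathcal N(e')\Downarrow\mathbf{return}\,V.$$
   Context: **Source language.** Types $\tau::=\mathbf{unit}\mid\mathbf{bool}\mid\tau_1\times\tau_2\mid\tau\to\tau'$; expressions $e::=x\mid()\mid(e_1,e_2)\mid\mathbf{fst}\,e\mid\mathbf{snd}\,e\mid\mathbf{true}\mid\mathbf{false}\mid\mathbf{if}\,e_0\,\mathbf{then}\,e_1\,\mathbf{else}\,e_2\mid\lambda x{:}\tau.e\mid e\,e'\mid\mathbf{rec}\,f{:}\tau\to\tau'.\lambda x.e$, with the usual simply typed rules $\Gamma\vdash e:\tau$, and $\Gamma\vdash\mathbf{rec}\,f{:}\tau\to\tau'.\lambda x.e:\tau\to\tau'$ if $\Gamma,f:\tau\to\tau',x:\tau\vdash e:\tau'$. **Model.** $\omega\mathbf{Cpo}$ has as objects posets with least upper bounds of $\omega$-chains, and as morphisms $\omega$-continuous functions, ordered pointwise ($\sqsubseteq$). Products are ordered componentwise; $X\Rightarrow Y$ is the set of $\omega$-continuous functions ordered pointwise; $1=\{*\}$ and $2=\{\mathit{true},\mathit{false}\}$ is discrete. $TX$ freely adjoins a least element $\bot$ to $X$; $\eta_X:X\to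 TX$ is the inclusion. A $\mathsf T$-algebra is an $\omega$cpo $Z$ with a least element $\bot$; for $f:X\to Z$ the extension $f^\ddagger:TX\to Z$ maps $\bot$ to $\bot$ and $x\in X$ to $f(x)$; when $Z=TY$ this is written $f^\dagger$. $Tf=(\eta\circ f)^\dagger$. $\mathrm{seq}^L:TX_1\times TX_2\to T(X_1\times X_2)$ maps $(x_1,x_2)$ to $(x_1,x_2)$ if both $x_i\ne\bot$ and to $\bot$ otherwise; $\langle\!\langle f_1,f_2\rangle\!\rangle=\mathrm{seq}^L\circ\langle f_1,f_2\rangle$. $\mathrm{fix}\,f$ is the least fixed point of an $\omega$-continuous $f:Z\to Z$ on an $\omega$cpo with least element. $\mathrm{ev}$ is function evaluation. **Call-by-value semantics.** $\mathcal V[\![\mathbf{unit}]\!]=1$, $\mathcal V[\![\mathbf{bool}]\!]=2$, $\mathcal V[\![\tau_1\times\tau_2]\!]=\mathcal V[\![\tau_1]\!]\times\mathcal V[\![\tau_2]\!]$, $\mathcal V[\![\tau\to\tau']\!]=\mathcal V[\![\tau]\!]\Rightarrow T\mathcal V[\![\tau']\!]$; contexts are products. $\mathcal V[\![e]\!]:\mathcal V[\![\Gamma]\!]\to T\mathcal V[\![\tau]\!]$ at $\rho$: $x\mapsto\eta(\rho_x)$; $()\mapsto\eta( * )$; $(e_1,e_2)\mapsto\mathrm{seq}^L(\mathcal V[\![e_1]\!]\rho,\mathcal V[\![e_2]\!]\rho)$; $\mathbf{fst}\,e\mapsto T\pi_1(\mathcal V[\![e]\!]\rho)$, similarly $\mathbf{snd}$;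 $\mathbf{true}\mapsto\eta(\mathit{true})$, $\mathbf{false}\mapsto\eta(\mathit{false})$; $\mathbf{if}\,e_0\,\mathbf{then}\,e_1\,\mathbf{else}\,e_2\mapsto(b\mapsto\mathcal V[\![e_1]\!]\rho\text{ if }b=\mathit{true},\ \mathcal V[\![e_2]\!]\rho\text{ if }b=\mathit{false})^\dagger(\mathcal V[\![e_0]\!]\rho)$; $\lambda x.e\mapsto\eta(a\mapsto\mathcal V[\![e]\!](\rho,a))$; $e\,e'\mapsto\mathrm{ev}^\dagger(\mathrm{seq}^L(\mathcal V[\![e]\!]\rho,\mathcal V[\![e']\!]\rho))$; $\mathbf{rec}\,f.\lambda x.e\mapsto\eta\big(\mathrm{fix}(g\mapsto(a\mapsto\mathcal V[\![e]\!](\rho,g,a)))\big)$ with $g\in\mathcal V[\![\tau\to\tau']\!]$. **Call-by-name semantics.** $\mathcal N[\![\tau]\!]$ is an $\omega$cpo with least element: $\mathcal N[\![\mathbf{unit}]\!]=T1$, $\mathcal N[\![\mathbf{bool}]\!]=T2$, $\mathcal N[\![\tau_1\times\tau_2]\!]=\mathcal N[\![\tau_1]\!]\times\mathcal N[\![\tau_2]\!]$, $\mathcal N[\![\tau\to\tau']\!]=\mathcal N[\![\tau]\!]\Rightarrow\mathcal N[\![\tau']\!]$; contexts are products. $\mathcal N[\![e]\!]:\mathcal N[\![\Gamma]\!]\to\mathcal N[\![\tau]\!]$ at $\rho$: $x\mapsto\rho_x$; $()\mapsto\eta( * )$; $(e_1,e_2)\mapsto(\mathcal N[\![e_1]\!]\rho,\mathcal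 N[\![e_2]\!]\rho)$; $\mathbf{fst}\,e\mapsto\pi_1(\mathcal N[\![e]\!]\rho)$, similarly $\mathbf{snd}$; $\mathbf{true}\mapsto\eta(\mathit{true})$, $\mathbf{false}\mapsto\eta(\mathit{false})$; $\mathbf{if}\,e_0\,\mathbf{then}\,e_1\,\mathbf{else}\,e_2\mapsto(b\mapsto\mathcal N[\![e_1]\!]\rho\text{ if }b=\mathit{true},\ \mathcal N[\![e_2]\!]\rho\text{ if }b=\mathit{false})^\ddagger(\mathcal N[\![e_0]\!]\rho)$; $\lambda x.e\mapsto(a\mapsto\mathcal N[\![e]\!](\rho,a))$; $e\,e'\mapsto(\mathcal N[\![e]\!]\rho)(\mathcal N[\![e']\!]\rho)$; $\mathbf{rec}\,f.\lambda x.e\mapsto\mathrm{fix}(g\mapsto(a\mapsto\mathcal N[\![e]\!](\rho,g,a)))$. **The relations.** For $\omega$-continuous $f^v:W\to T\mathcal V[\![\tau]\!]$, $f^n:W\to\mathcal N[\![\tau]\!]$, $f^v\,\mathcal R[\![\tau]\!]_W\,f^n$ is defined by induction on $\tau$: for $\tau\in\{\mathbf{unit},\mathbf{bool}\}$, iff $f^v\sqsubseteq f^n$; for $\tau_1\times\tau_2$, iff $(T\pi_i\circ f^v)\,\mathcal R[\![\tau_i]\!]_W\,(\pi_i\circ f^n)$ for $i=1,2$; for $\tau\to\tau'$, iff for all objects $W'$ and morphisms $w:W'\to W$, $g^v:W'\to T\mathcal V[\![\tau]\!]$, $g^n:W'\to\mathcal N[\![\tau]\!]$, $g^v\,\mathcal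 R[\![\tau]\!]_{W'}\,g^n$ implies $(\mathrm{ev}^\dagger\circ\langle\!\langle f^v\circ w,g^v\rangle\!\rangle)\,\mathcal R[\![\tau']\!]_{W'}\,(\mathrm{ev}\circ\langle f^n\circ w,g^n\rangle)$. Let $\langle\!\langle f_i\rangle\!\rangle_i$ denote iterated left-nested $\langle\!\langle-,-\rangle\!\rangle$ starting from $\eta_1\circ\langle\rangle_W$ (with $\langle\rangle_W:W\to1$), and $\langle f_i\rangle_i$ iterated pairing. For $\Gamma=x_1:\tau_1,\dots,x_k:\tau_k$, $g^v:\mathcal V[\![\Gamma]\!]\to T\mathcal V[\![\tau]\!]$, $g^n:\mathcal N[\![\Gamma]\!]\to\mathcal N[\![\tau]\!]$, write $g^v\ltimes g^n$ if for all objects $W$ and families $f_i^v:W\to T\mathcal V[\![\tau_i]\!]$, $f_i^n:W\to\mathcal N[\![\tau_i]\!]$ with $f_i^v\,\mathcal R[\![\tau_i]\!]_W\,f_i^n$ for all $i$, we have $((g^v)^\dagger\circ\langle\!\langle f_i^v\rangle\!\rangle_i)\,\mathcal R[\![\tau]\!]_W\,(g^n\circ\langle f_i^n\rangle_i)$. **Call-by-push-value (CBPV) with recursion.** Value types $A::=\mathbf{unit}\mid A_1\times A_2\mid\mathbf{bool}\mid\mathbf U\,\underline C$; computation types $\underline C::=\underline C_1\underline\times\,\underline C_2\mid A\to\underline C\mid\mathbf F A$. Values $V::=x\mid()\mid(V_1,V_2)\mid\mathbf{true}\mid\mathbf{false}\mid\mathbf{thunk}\,M$. Computations $M::=\lambda\{1.M_1,2.M_2\}\mid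 1\text{`}M\mid2\text{`}M\mid\lambda x{:}A.M\mid V\text{`}M\mid\mathbf{return}\,V\mid M\,\mathbf{to}\,x.\,N\mid\mathbf{match}\,V\,\mathbf{with}\,(x_1,x_2).M\mid\mathbf{if}\,V\,\mathbf{then}\,M_1\,\mathbf{else}\,M_2\mid\mathbf{force}\,V\mid\mathbf{rec}\,x{:}\mathbf U\underline C.M$. Typing: values are typed in the evident way, with $\mathbf{thunk}\,M:\mathbf U\underline C$ if $M:\underline C$; for computations, $\lambda\{1.M_1,2.M_2\}:\underline C_1\underline\times\,\underline C_2$ if $M_i:\underline C_i$; $i\text{`}M:\underline C_i$ if $M:\underline C_1\underline\times\,\underline C_2$; $\lambda x{:}A.M:A\to\underline C$ if $M:\underline C$ assuming $x:A$; $V\text{`}M:\underline C$ if $V:A$, $M:A\to\underline C$; $\mathbf{return}\,V:\mathbf FA$ if $V:A$; $M\,\mathbf{to}\,x.N:\underline C$ if $M:\mathbf FA$ and $N:\underline C$ assuming $x:A$; match and if are the evident eliminators into any $\underline C$; $\mathbf{force}\,V:\underline C$ if $V:\mathbf U\underline C$; $\mathbf{rec}\,x{:}\mathbf U\underline C.M:\underline C$ if $M:\underline C$ assuming $x:\mathbf U\underline C$. Big-step evaluation $M\Downarrow R$ on closed well-typed computations is generated by: $R\Downarrow R$ for $R$ of the form $\lambda\{1.M_1,2.M_2\}$, $\lambda x{:}A.M$, or $\mathbf{return}\,V$; $i\text{`}M\Downarrow R$ if $M\Downarrow\lambda\{1.N_1,2.N_2\}$ and $N_i\Downarrow R$; $V\text{`}M\Downarrow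 R$ if $M\Downarrow\lambda x{:}A.N$ and $N[x\mapsto V]\Downarrow R$; $M\,\mathbf{to}\,x.N\Downarrow R$ if $M\Downarrow\mathbf{return}\,V$ and $N[x\mapsto V]\Downarrow R$; $\mathbf{if}\,\mathbf{true}\,\mathbf{then}\,M_1\,\mathbf{else}\,M_2\Downarrow R$ if $M_1\Downarrow R$; $\mathbf{if}\,\mathbf{false}\,\mathbf{then}\,M_1\,\mathbf{else}\,M_2\Downarrow R$ if $M_2\Downarrow R$; $\mathbf{match}\,(V_1,V_2)\,\mathbf{with}\,(x_1,x_2).M\Downarrow R$ if $M[x_1\mapsto V_1,x_2\mapsto V_2]\Downarrow R$; $\mathbf{force}(\mathbf{thunk}\,M)\Downarrow R$ if $M\Downarrow R$; $\mathbf{rec}\,x{:}\mathbf U\underline C.M\Downarrow R$ if $M[x\mapsto\mathbf{thunk}(\mathbf{rec}\,x{:}\mathbf U\underline C.M)]\Downarrow R$. **Call-by-value translation.** $\mathcal V(\mathbf{unit})=\mathbf{unit}$, $\mathcal V(\mathbf{bool})=\mathbf{bool}$, $\mathcal V(\tau_1\times\tau_2)=\mathcal V(\tau_1)\times\mathcal V(\tau_2)$, $\mathcal V(\tau\to\tau')=\mathbf U(\mathcal V(\tau)\to\mathbf F\mathcal V(\tau'))$. For $\Gamma\vdash e:\tau$, $\mathcal V(e):\mathbf F\mathcal V(\tau)$ (with $x_i:\mathcal V(\tau_i)$): $x\mapsto\mathbf{return}\,x$; $()\mapsto\mathbf{return}\,()$; $(e_1,e_2)\mapsto\mathcal V(e_1)\,\mathbf{to}\,z_1.\,\mathcal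 V(e_2)\,\mathbf{to}\,z_2.\,\mathbf{return}\,(z_1,z_2)$; $\mathbf{fst}\,e\mapsto\mathcal V(e)\,\mathbf{to}\,z.\,\mathbf{match}\,z\,\mathbf{with}\,(z_1,z_2).\mathbf{return}\,z_1$, similarly $\mathbf{snd}$; $\mathbf{true}\mapsto\mathbf{return}\,\mathbf{true}$, $\mathbf{false}\mapsto\mathbf{return}\,\mathbf{false}$; $\mathbf{if}\,e_0\,\mathbf{then}\,e_1\,\mathbf{else}\,e_2\mapsto\mathcal V(e_0)\,\mathbf{to}\,z.\,\mathbf{if}\,z\,\mathbf{then}\,\mathcal V(e_1)\,\mathbf{else}\,\mathcal V(e_2)$; $\lambda x{:}\tau.e\mapsto\mathbf{return}\,\mathbf{thunk}\,\lambda x{:}\mathcal V(\tau).\mathcal V(e)$; $e\,e'\mapsto\mathcal V(e)\,\mathbf{to}\,y.\,\mathcal V(e')\,\mathbf{to}\,z.\,z\text{`}\mathbf{force}\,y$; $\mathbf{rec}\,f{:}\tau\to\tau'.\lambda x.e\mapsto\mathbf{return}\,\mathbf{thunk}(\mathbf{rec}\,f{:}\mathbf U(\mathcal V(\tau)\to\mathbf F\mathcal V(\tau')).\lambda x{:}\mathcal V(\tau).\mathcal V(e))$. **Call-by-name translation.** $\mathcal N(\mathbf{unit})=\mathbf F\,\mathbf{unit}$, $\mathcal N(\mathbf{bool})=\mathbf F\,\mathbf{bool}$, $\mathcal N(\tau_1\times\tau_2)=\mathcal N(\tau_1)\underline\times\,\mathcal N(\tau_2)$, $\mathcal N(\tau\to\tau')=\mathbf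 U\mathcal N(\tau)\to\mathcal N(\tau')$. For $\Gamma\vdash e:\tau$, $\mathcal N(e):\mathcal N(\tau)$ (with $x_i:\mathbf U\mathcal N(\tau_i)$): $x\mapsto\mathbf{force}\,x$; $()\mapsto\mathbf{return}\,()$; $(e_1,e_2)\mapsto\lambda\{1.\mathcal N(e_1),2.\mathcal N(e_2)\}$; $\mathbf{fst}\,e\mapsto1\text{`}\mathcal N(e)$; $\mathbf{snd}\,e\mapsto2\text{`}\mathcal N(e)$; $\mathbf{true}\mapsto\mathbf{return}\,\mathbf{true}$, $\mathbf{false}\mapsto\mathbf{return}\,\mathbf{false}$; $\mathbf{if}\,e_0\,\mathbf{then}\,e_1\,\mathbf{else}\,e_2\mapsto\mathcal N(e_0)\,\mathbf{to}\,z.\,\mathbf{if}\,z\,\mathbf{then}\,\mathcal N(e_1)\,\mathbf{else}\,\mathcal N(e_2)$; $\lambda x{:}\tau.e\mapsto\lambda x{:}\mathbf U\mathcal N(\tau).\mathcal N(e)$; $e\,e'\mapsto(\mathbf{thunk}\,\mathcal N(e'))\text{`}\mathcal N(e)$; $\mathbf{rec}\,f{:}\tau\to\tau'.\lambda x.e\mapsto\mathbf{rec}\,f{:}\mathbf U(\mathbf U\mathcal N(\tau)\to\mathcal N(\tau')).\lambda x{:}\mathbf U\mathcal N(\tau).\mathcal N(e)$. (Auxiliary variables are fresh.) *)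

(* Defs.v *)
From Stdlib Require Import List Arith Lia Classical ClassicalEpsilon
  FunctionalExtensionality ProofIrrelevance.
Import ListNotations.

Set Implicit Arguments.
Unset Strict Implicit.
Unset Printing Implicit Defensive.

Definition is_chain (X : Type) (le : X -> X -> Prop) (c : nat -> X) : Prop :=
  forall n, le (c n) (c (S n)).

Definition is_lub (X : Type) (le : X -> X -> Prop) (c : nat -> X) (x : X) : Prop :=
  (forall n, le (c n) x) /\ (forall y, (forall n, le (c n) y) -> le x y).

Record cpo : Type := Cpo {
  carrier :> Type;
  le : carrier -> carrier -> Prop;
  le_refl : forall x, le x x;
  le_trans : forall x y z, le x y -> le y z -> le x z;
  le_antisym : forall x y, le x y -> le y x -> x = y;
  has_lub : forall c, is_chain le c -> exists x, is_lub le c x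
}.

Arguments le {c} _ _ : rename.
Infix "⊑" := le (at level 70, no associativity).
Notation chain := (is_chain le).
Notation lub_of := (is_lub le).

Record cont (X Y : cpo) : Type := Cont {
  fn :> X -> Y;
  fn_mono : forall x x', x ⊑ x' -> fn x ⊑ fn x';
  fn_lub : forall c x, chain c -> lub_of c x -> lub_of (fun n => fn (c n)) (fn x)
}.

Infix "~>" := cont (at level 99, right associativity).

Lemma cont_ext (X Y : cpo) (f g : X ~> Y) : (forall x, f x = g x) -> f = g.
Proof.
  destruct f as [f f1 f2], g as [g g1 g2]; simpl; intros H.
  assert (E : f = g) by (apply functional_extensionality; exact H).
  subst g. f_equal; apply proof_irrelevance.
Qed.

Lemma chain_le (X : cpo) (c : nat -> X) :
  chain c -> forall m n, m <= n -> c m ⊑ c n.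
Proof.
  intros H m n L; induction L as [|n L IH].
  - apply le_refl.
  - eapply le_trans; [exact IH | apply H].
Qed.

Lemma lub_unique (X : cpo) (c : nat -> X) x y : lub_of c x -> lub_of c y -> x = y.
Proof.
  intros [U L] [U' L']; apply le_antisym; [apply L, U' | apply L', U].
Qed.

Lemma lub_const (X : cpo) (x : X) : lub_of (fun _ => x) x.
Proof.
  split; [intros _; apply le_refl | intros y H; exact (H 0)].
Qed.

Lemma lub_shift (X : cpo) (c : nat -> X) n x :
  chain c -> lub_of c x <-> lub_of (fun k => c (n + k)) x.
Proof.
  intros H; split; intros [U L]; split.
  - intros k; apply U.
  - intros y Hy; apply L; intros m.
    eapply le_trans; [|apply (Hy m)]. apply chain_le; [exact H | lia].
  - intros m; eapply le_trans; [|apply (U m)]. apply chain_le; [exact H | lia].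
  - intros y Hy; apply L; intros k; apply Hy.
Qed.

Definition idc (X : cpo) : X ~> X.
Proof.
  refine (@Cont X X (fun x => x) _ _); auto.
Defined.

Definition comp (X Y Z : cpo) (g : Y ~> Z) (f : X ~> Y) : X ~> Z.
Proof.
  refine (@Cont X Z (fun x => g (f x)) _ _).
  - intros; do 2 apply fn_mono; assumption.
  - intros c x Hc Hx.
    apply (@fn_lub _ _ g (fun n => f (c n))).
    + intros n; apply fn_mono, Hc.
    + apply fn_lub; assumption.
Defined.

Infix "∘" := comp (at level 40, left associativity).

Definition constc (X Y : cpo) (y : Y) : X ~> Y.
Proof.
  refine (@Cont X Y (fun _ => y) _ _).
  - intros; apply le_refl.
  - intros; apply lub_const.
Defined.

Definition discrete (A : Type) : cpo.
Proof.
  refine (@Cpo A eq _ _ _ _).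
  - reflexivity.
  - intros; congruence.
  - auto.
  - intros c H; exists (c 0); split.
    + intros n; induction n as [|n IH]; [reflexivity | rewrite <- (H n); exact IH].
    + intros y Hy; apply Hy.
Defined.

Definition cone : cpo := discrete unit.
Definition ctwo : cpo := discrete bool.

Definition bang (W : cpo) : W ~> cone := @constc W cone tt.

Definition cprod (X Y : cpo) : cpo.
Proof.
  refine (@Cpo (X * Y) (fun p q => fst p ⊑ fst q /\ snd p ⊑ snd q) _ _ _ _).
  - intros; split; apply le_refl.
  - intros x y z [H1 H2] [H3 H4]; split; eapply le_trans; eassumption.
  - intros [a b] [a' b']; simpl; intros [H1 H2] [H3 H4]; f_equal;
      apply le_antisym; assumption.
  - intros c H.
    destruct (@has_lub X (fun n => fst (c n))) as [x [Ux Lx]]; [intros n; apply H|].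
    destruct (@has_lub Y (fun n => snd (c n))) as [y [Uy Ly]]; [intros n; apply H|].
    exists (x, y); split.
    + intros n; split; [apply Ux | apply Uy].
    + intros z Hz; split; [apply Lx | apply Ly]; intros n; apply Hz.
Defined.

Lemma prod_lub (X Y : cpo) (c : nat -> cprod X Y) (x : cprod X Y) :
  lub_of c x <-> lub_of (fun n => fst (c n)) (fst x) /\ lub_of (fun n => snd (c n)) (snd x).
Proof.
  split.
  - intros [U L]; split; split.
    + intros n; apply U.
    + intros y Hy. apply (L (y, snd x)). intros n; split; [apply Hy | apply U].
    + intros n; apply U.
    + intros y Hy. apply (L (fst x, y)). intros n; split; [apply U | apply Hy].
  - intros [[U L] [U' L']]; split.
    + intros n; split; [apply U | apply U'].
    + intros z Hz; split; [apply L | apply L']; intros n; apply Hz.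
Qed.

Definition pi1 (X Y : cpo) : cprod X Y ~> X.
Proof.
  refine (@Cont (cprod X Y) X (fun p => fst p) _ _).
  - intros x x' H; apply H.
  - intros c x _ H; apply prod_lub, H.
Defined.

Definition pi2 (X Y : cpo) : cprod X Y ~> Y.
Proof.
  refine (@Cont (cprod X Y) Y (fun p => snd p) _ _).
  - intros x x' H; apply H.
  - intros c x _ H; apply prod_lub, H.
Defined.

Definition pairc (W X Y : cpo) (f : W ~> X) (g : W ~> Y) : W ~> cprod X Y.
Proof.
  refine (@Cont W (cprod X Y) (fun w => (f w, g w)) _ _).
  - intros; split; apply fn_mono; assumption.
  - intros c x Hc Hx; apply prod_lub; split; apply fn_lub; assumption.
Defined.

Definition cont2 (X Y Z : cpo) (f : X -> Y -> Z)
  (m1 : forall x x' y, x ⊑ x' -> f x y ⊑ f x' y)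
  (m2 : forall x y y', y ⊑ y' -> f x y ⊑ f x y')
  (l1 : forall c x y, chain c -> lub_of c x -> lub_of (fun n => f (c n) y) (f x y))
  (l2 : forall x c y, chain c -> lub_of c y -> lub_of (fun n => f x (c n)) (f x y)) :
  cprod X Y ~> Z.
Proof.
  refine (@Cont (cprod X Y) Z (fun p => f (fst p) (snd p)) _ _).
  - intros p q [H1 H2]; eapply le_trans; [apply m1, H1 | apply m2, H2].
  - intros c p Hc Hp; pose proof Hp as Hp'.
    apply prod_lub in Hp; destruct Hp as [Hx Hy]; split.
    + intros n; eapply le_trans; [apply m1, Hx | apply m2, Hy].
    + intros z Hz.
      apply (l1 (fun n => fst (c n)) (fst p) (snd p)); [intros n; apply Hc | exact Hx |].
      intros n.
      apply (l2 (fst (c n)) (fun n => snd (c n)) (snd p)); [intros m; apply Hc | exact Hy |].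
      intros m.
      eapply le_trans; [|apply (Hz (n + m))].
      eapply le_trans; [apply m1 | apply m2];
        apply (chain_le Hc); lia.
Defined.

Lemma pointwise_lub (X Y : cpo) (c : nat -> (X ~> Y)) :
  (forall x, chain (fun n => c n x)) ->
  exists g : X ~> Y, forall x, lub_of (fun n => c n x) (g x).
Proof.
  intros H.
  pose (g := fun x => proj1_sig (constructive_indefinite_description _ (has_lub (H x)))).
  assert (Hg : forall x, lub_of (fun n => c n x) (g x)).
  { intros x; exact (proj2_sig (constructive_indefinite_description _ (has_lub (H x)))). }
  assert (M : forall x x', x ⊑ x' -> g x ⊑ g x').
  { intros x x' L; apply (Hg x); intros n.
    eapply le_trans; [apply fn_mono, L | apply Hg]. }
  unshelve eexists (@Cont X Y g M _); [|exact Hg].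
  intros d x Hd Hx; split.
  - intros n; apply M, Hx.
  - intros y Hy; apply (Hg x); intros m.
    apply (@fn_lub _ _ (c m) d x Hd Hx); intros n.
    eapply le_trans; [apply (Hg (d n)) | apply Hy].
Qed.

Definition cexp (X Y : cpo) : cpo.
Proof.
  refine (@Cpo (X ~> Y) (fun f g => forall x, f x ⊑ g x) _ _ _ _).
  - intros f x; apply le_refl.
  - intros f g h H1 H2 x; eapply le_trans; [apply H1 | apply H2].
  - intros f g H1 H2; apply cont_ext; intros x; apply le_antisym; auto.
  - intros c H.
    destruct (@pointwise_lub X Y c) as [g Hg]; [intros x n; apply H|].
    exists g; split.
    + intros n x; apply Hg.
    + intros h Hh x; apply (Hg x); intros n; apply Hh.
Defined.

Lemma exp_lub (X Y : cpo) (c : nat -> (X ~> Y)) (g : X ~> Y) :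
  @is_chain _ (@le (cexp X Y)) c ->
  (@is_lub _ (@le (cexp X Y)) c g <-> forall x, lub_of (fun n => c n x) (g x)).
Proof.
  intros H; split.
  - intros Hg.
    destruct (@pointwise_lub X Y c) as [h Hh]; [intros x n; apply H|].
    assert (E : g = h).
    { eapply (@lub_unique (cexp X Y)); [exact Hg|]; split.
      - intros n x; apply Hh.
      - intros k Hk x; apply (Hh x); intros n; apply Hk. }
    subst g; exact Hh.
  - intros Hg; split.
    + intros n x; apply Hg.
    + intros h Hh x; apply (Hg x); intros n; apply Hh.
Qed.

Definition ev (X Y : cpo) : cprod (cexp X Y) X ~> Y.
Proof.
  refine (@cont2 (cexp X Y) X Y (fun (f : X ~> Y) x => f x) _ _ _ _).
  - intros f g x H; apply H.
  - intros f x x' H; apply fn_mono, H.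
  - intros c g x Hc Hg; apply exp_lub; assumption.
  - intros f c x Hc Hx; apply fn_lub; assumption.
Defined.

Definition curry (W X Y : cpo) (h : cprod W X ~> Y) : W ~> cexp X Y.
Proof.
  refine (@Cont W (cexp X Y) (fun w => h ∘ pairc (constc X w) (idc X)) _ _).
  - intros w w' H x; apply (@fn_mono _ _ h (w, x) (w', x)); split; [exact H | apply le_refl].
  - intros c w Hc Hw; apply exp_lub.
    + intros n x; apply (@fn_mono _ _ h (c n, x) (c (S n), x)); split;
        [apply Hc | apply le_refl].
    + intros x.
      apply (@fn_lub _ _ h (fun n => (c n, x) : cprod W X) (w, x)).
      * intros n; split; [apply Hc | apply le_refl].
      * apply prod_lub; split; [exact Hw | apply (lub_const x)].
Defined.

Definition lift_le (X : cpo) (t u : option X) : Prop :=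
  match t, u with
  | None, _ => True
  | Some x, Some y => x ⊑ y
  | Some _, None => False
  end.

Lemma lift_chain_shift (X : cpo) (c : nat -> option X) n a :
  is_chain (@lift_le X) c -> c n = Some a ->
  exists d : nat -> X, (forall k, c (n + k) = Some (d k)) /\ chain d.
Proof.
  intros H E.
  assert (D : forall k, exists b, c (n + k) = Some b).
  { induction k as [|k [b IH]].
    - exists a; rewrite Nat.add_0_r; exact E.
    - specialize (H (n + k)); rewrite IH in H.
      replace (n + S k) with (S (n + k)) by lia.
      destruct (c (S (n + k))) as [b'|]; [exists b'; reflexivity | destruct H]. }
  pose (d := fun k => proj1_sig (constructive_indefinite_description _ (D k))).
  assert (Hd : forall k, c (n + k) = Some (d k)).
  { intros k; exact (proj2_sig (constructive_indefinite_description _ (D k))). }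
  exists d; split; [exact Hd|].
  intros k; specialize (H (n + k)).
  replace (S (n + k)) with (n + S k) in H by lia.
  rewrite !Hd in H; exact H.
Qed.

Lemma lift_lub_shift (X : cpo) (c : nat -> option X) n (d : nat -> X) a :
  is_chain (@lift_le X) c -> (forall k, c (n + k) = Some (d k)) ->
  (is_lub (@lift_le X) c (Some a) <-> lub_of d a).
Proof.
  intros H Hd.
  assert (T : forall t u v, @lift_le X t u -> lift_le u v -> lift_le t v).
  { intros [x|] [y|] [z|]; simpl; try tauto; apply le_trans. }
  assert (M : forall m k, lift_le (c m) (c (m + k))).
  { intros m k; induction k as [|k IH].
    - rewrite Nat.add_0_r; destruct (c m); simpl; [apply le_refl | exact I].
    - replace (m + S k) with (S (m + k)) by lia; eapply T; [exact IH | apply H]. }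
  split; intros [U L]; split.
  - intros k; specialize (U (n + k)); rewrite Hd in U; exact U.
  - intros y Hy; apply (L (Some y)); intros m.
    eapply T; [apply (M m n)|].
    rewrite Nat.add_comm, Hd; apply Hy.
  - intros m; eapply T; [apply (M m n)|].
    rewrite Nat.add_comm, Hd; apply U.
  - intros [y|] Hy.
    + apply L; intros k; specialize (Hy (n + k)); rewrite Hd in Hy; exact Hy.
    + specialize (Hy (n + 0)); rewrite Hd in Hy; destruct Hy.
Qed.

Definition lift (X : cpo) : cpo.
Proof.
  refine (@Cpo (option X) (@lift_le X) _ _ _ _).
  - intros [x|]; simpl; [apply le_refl | exact I].
  - intros [x|] [y|] [z|]; simpl; try tauto; apply le_trans.
  - intros [x|] [y|]; simpl; try tauto.
    intros H1 H2; f_equal; apply le_antisym; assumption.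
  - intros c H.
    destruct (classic (exists n a, c n = Some a)) as [(n & a & E)|N].
    + destruct (lift_chain_shift H E) as (d & Hd & Cd).
      destruct (has_lub Cd) as [x Hx].
      exists (Some x); apply (lift_lub_shift x H Hd), Hx.
    + exists None; split.
      * intros n; destruct (c n) as [a|] eqn:E; [|exact I].
        destruct N; exists n, a; exact E.
      * intros y _; exact I.
Defined.

Lemma lift_lub_some (X : cpo) (c : nat -> lift X) (a : X) :
  chain c -> lub_of c (Some a : lift X) ->
  exists n (d : nat -> X), (forall k, c (n + k) = Some (d k)) /\ chain d /\ lub_of d a.
Proof.
  intros H Ha.
  destruct (classic (exists n a, c n = Some a)) as [(n & b & E)|N].
  - destruct (lift_chain_shift H E) as (d & Hd & Cd).
    exists n, d; split; [exact Hd|]; split; [exact Cd|].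
    apply (lift_lub_shift a H Hd), Ha.
  - exfalso; apply (proj2 Ha None); intros n.
    destruct (c n) as [b|] eqn:E; [|exact I].
    destruct N; exists n, b; exact E.
Qed.

Definition eta (X : cpo) : X ~> lift X.
Proof.
  refine (@Cont X (lift X) (fun x => Some x) _ _).
  - intros x x' H; exact H.
  - intros c x Hc Hx.
    apply (@lift_lub_shift X (fun n => Some (c n)) 0 c x Hc (fun k => eq_refl)), Hx.
Defined.

Record alg : Type := Alg {
  alg_cpo :> cpo;
  bot : alg_cpo;
  bot_le : forall x, bot ⊑ x
}.

Arguments bot {a} : rename.

Definition lift_alg (X : cpo) : alg := @Alg (lift X) None (fun _ => I).

Definition prod_alg (Z1 Z2 : alg) : alg :=
  @Alg (cprod Z1 Z2) (bot, bot) (fun x => conj (bot_le (fst x)) (bot_le (snd x))).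

Definition exp_alg (X : cpo) (Z : alg) : alg :=
  @Alg (cexp X Z) (constc X bot) (fun f x => bot_le (f x)).

Definition ext_fn (X : cpo) (Z : alg) (f : X -> Z) (t : lift X) : Z :=
  match t with None => bot | Some x => f x end.

Definition ext (X : cpo) (Z : alg) (f : X ~> Z) : lift X ~> Z.
Proof.
  refine (@Cont (lift X) Z (ext_fn f) _ _).
  - intros [x|] [y|]; simpl; intros H; try (apply bot_le); [apply fn_mono, H | destruct H].
  - intros c t Hc Ht.
    assert (M : forall x y : lift X, x ⊑ y -> ext_fn f x ⊑ ext_fn f y).
    { intros [x|] [y|]; simpl; intros H; try (apply bot_le); [apply fn_mono, H | destruct H]. }
    split.
    + intros n; apply M, Ht.
    + destruct t as [a|]; [|intros; apply bot_le].
      intros z Hz.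
      destruct (lift_lub_some Hc Ht) as (n & d & Hd & Cd & Ha).
      apply (@fn_lub _ _ f d a Cd Ha); intros k.
      specialize (Hz (n + k)); rewrite Hd in Hz; exact Hz.
Defined.

Definition dagger (X Y : cpo) (f : X ~> lift Y) : lift X ~> lift Y :=
  @ext X (lift_alg Y) f.

Definition lift_map (X Y : cpo) (f : X ~> Y) : lift X ~> lift Y :=
  dagger (eta Y ∘ f).

Definition seqL_fn (X1 X2 : cpo) (t1 : lift X1) (t2 : lift X2) : lift (cprod X1 X2) :=
  match t1, t2 with
  | Some x1, Some x2 => Some (x1, x2)
  | _, _ => None
  end.

Definition seqL (X1 X2 : cpo) : cprod (lift X1) (lift X2) ~> lift (cprod X1 X2).
Proof.
  refine (@cont2 (lift X1) (lift X2) (lift (cprod X1 X2)) (@seqL_fn X1 X2) _ _ _ _).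
  - intros [x|] [x'|] [y|]; simpl; try tauto.
    intros H; split; [exact H | apply le_refl].
  - intros [x|] [y|] [y'|]; simpl; try tauto.
    intros H; split; [apply le_refl | exact H].
  - intros c x [y|] Hc Hx.
    + pose (f := lift_map (pairc (idc X1) (constc X1 y))).
      assert (E : forall t, seqL_fn t (Some y) = f t) by (intros [t|]; reflexivity).
      rewrite E.
      replace (fun n => seqL_fn (c n) (Some y)) with (fun n => f (c n))
        by (apply functional_extensionality; intros n; symmetry; apply E).
      apply fn_lub; assumption.
    + assert (E : forall t : lift X1, @seqL_fn X1 X2 t None = None)
        by (intros [t|]; reflexivity).
      rewrite E.
      replace (fun n => @seqL_fn X1 X2 (c n) None)
        with (fun _ : nat => None : lift (cprod X1 X2))
        by (apply functional_extensionality; intros n; symmetry; apply E).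
      apply lub_const.
  - intros [x|] c y Hc Hy.
    + pose (f := lift_map (pairc (constc X2 x) (idc X2))).
      assert (E : forall t, seqL_fn (Some x) t = f t) by (intros [t|]; reflexivity).
      rewrite E.
      replace (fun n => seqL_fn (Some x) (c n)) with (fun n => f (c n))
        by (apply functional_extensionality; intros n; symmetry; apply E).
      apply fn_lub; assumption.
    + simpl; apply (@lub_const (lift (cprod X1 X2))).
Defined.

Definition dpair (W X1 X2 : cpo) (f1 : W ~> lift X1) (f2 : W ~> lift X2) :
  W ~> lift (cprod X1 X2) :=
  seqL X1 X2 ∘ pairc f1 f2.

Definition cond_fn (W : cpo) (Z : alg) (f g : W ~> Z) (w : W) (t : lift ctwo) : Z :=
  ext_fn (X := ctwo) (fun b : bool => if b then f w else g w) t.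

Definition cond (W : cpo) (Z : alg) (h : W ~> lift ctwo) (f g : W ~> Z) : W ~> Z.
Proof.
  refine (@cont2 W (lift ctwo) Z (cond_fn f g) _ _ _ _ ∘ pairc (idc W) h).
  - intros w w' [[|]|] H; simpl; try (apply fn_mono, H); apply le_refl.
  - intros w [b|] [b'|] H; simpl in *; try (apply bot_le); [|destruct H].
    rewrite H; apply le_refl.
  - intros c w [[|]|] Hc Hw; simpl.
    + apply fn_lub; assumption.
    + apply fn_lub; assumption.
    + apply lub_const.
  - intros w c t Hc Ht.
    assert (A : exists k : ctwo ~> Z, forall b : bool, k b = if b then f w else g w).
    { unshelve eexists (@Cont ctwo Z (fun b : bool => if b then f w else g w) _ _).
      - intros b b' H; rewrite H; apply le_refl.
      - intros d b Hd [U _].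
        replace (fun n => if (d n : bool) then f w else g w)
          with (fun _ : nat => if (b : bool) then f w else g w)
          by (apply functional_extensionality; intros n; rewrite (U n); reflexivity).
        apply lub_const.
      - reflexivity. }
    destruct A as [k Hk].
    assert (E : forall u, cond_fn f g w u = ext k u).
    { intros [b|]; simpl; [symmetry; apply Hk | reflexivity]. }
    rewrite E.
    replace (fun n => cond_fn f g w (c n)) with (fun n => ext k (c n))
      by (apply functional_extensionality; intros n; symmetry; apply E).
    apply fn_lub; assumption.
Defined.

Definition is_lfp (Z : cpo) (f : Z ~> Z) (x : Z) : Prop :=
  f x = x /\ forall y, f y = y -> x ⊑ y.

Definition iter (Z : alg) (f : Z ~> Z) (n : nat) : Z := Nat.iter n f bot.

Lemma iter_chain (Z : alg) (f : Z ~> Z) : chain (iter f).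
Proof.
  intros n; induction n as [|n IH]; [apply bot_le | apply fn_mono, IH].
Qed.

Lemma kleene (Z : alg) (f : Z ~> Z) x : lub_of (iter f) x -> is_lfp f x.
Proof.
  intros Hx; split.
  - apply lub_unique with (c := fun n => f (iter f n)).
    + apply fn_lub; [apply iter_chain | exact Hx].
    + apply (lub_shift 1 x (iter_chain f)), Hx.
  - intros y Hy; apply Hx; intros n; induction n as [|n IH]; [apply bot_le|].
    rewrite <- Hy; apply fn_mono, IH.
Qed.

Lemma lfp_exists (Z : alg) (f : Z ~> Z) : exists x, is_lfp f x.
Proof.
  destruct (has_lub (iter_chain f)) as [x Hx]; exists x; apply kleene, Hx.
Qed.

Definition fix_fn (Z : alg) (f : Z ~> Z) : Z :=
  proj1_sig (constructive_indefinite_description _ (lfp_exists f)).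

Lemma fix_lfp (Z : alg) (f : Z ~> Z) : is_lfp f (fix_fn f).
Proof.
  exact (proj2_sig (constructive_indefinite_description _ (lfp_exists f))).
Qed.

Lemma fix_lub (Z : alg) (f : Z ~> Z) : lub_of (iter f) (fix_fn f).
Proof.
  destruct (has_lub (iter_chain f)) as [x Hx].
  replace (fix_fn f) with x; [exact Hx|].
  destruct (kleene Hx) as [E L]; destruct (fix_lfp f) as [E' L'].
  apply le_antisym; auto.
Qed.

Lemma fix_prefixed (Z : alg) (f : Z ~> Z) y : f y ⊑ y -> fix_fn f ⊑ y.
Proof.
  intros H; apply (fix_lub f); intros n; induction n as [|n IH]; [apply bot_le|].
  eapply le_trans; [apply fn_mono, IH | exact H].
Qed.

Lemma fix_mono (Z : alg) (f g : Z ~> Z) :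
  (forall x, f x ⊑ g x) -> fix_fn f ⊑ fix_fn g.
Proof.
  intros H; apply fix_prefixed.
  eapply le_trans; [apply H | rewrite (proj1 (fix_lfp g)); apply le_refl].
Qed.

Definition cfix (Z : alg) : cexp Z Z ~> Z.
Proof.
  refine (@Cont (cexp Z Z) Z (fun f : Z ~> Z => fix_fn f) _ _).
  - intros f g H; apply fix_mono, H.
  - intros c f Hc Hf.
    assert (Cf : chain (fun n => fix_fn (c n))) by (intros n; apply fix_mono, Hc).
    split; [intros n; apply fix_mono, Hf|].
    intros z Hz.
    destruct (has_lub Cf) as [l Hl].
    apply le_trans with l; [|apply Hl, Hz].
    apply fix_prefixed.
    apply (proj1 (exp_lub f Hc) Hf l); intros n.
    apply (@fn_lub _ _ (c n) _ l Cf Hl); intros m.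
    eapply le_trans; [|apply (proj1 Hl (n + m))].
    rewrite <- (proj1 (fix_lfp (c (n + m)))).
    eapply le_trans; [apply fn_mono | apply (chain_le Hc)].
    + apply (chain_le Cf); lia.
    + lia.
Defined.

(** Terms are intrinsically typed, with de Bruijn variables: an element of
    [tm Γ τ] is a derivation of [Γ ⊢ e : τ].  The head of a context is its most
    recently bound variable. *)

Inductive var (A : Type) : list A -> A -> Type :=
| VZ : forall Γ a, var (a :: Γ) a
| VS : forall Γ a b, var Γ a -> var (b :: Γ) a.

Arguments VZ {A Γ a}.
Arguments VS {A Γ a b} _.

Inductive ty : Type :=
| TUnit
| TBool
| TProd (τ1 τ2 : ty)
| TArr (τ τ' : ty).

Inductive tm : list ty -> ty -> Type :=
| EVar : forall Γ τ, var Γ τ -> tm Γ τ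
| EUnit : forall Γ, tm Γ TUnit
| EPair : forall Γ τ1 τ2, tm Γ τ1 -> tm Γ τ2 -> tm Γ (TProd τ1 τ2)
| EFst : forall Γ τ1 τ2, tm Γ (TProd τ1 τ2) -> tm Γ τ1
| ESnd : forall Γ τ1 τ2, tm Γ (TProd τ1 τ2) -> tm Γ τ2
| ETrue : forall Γ, tm Γ TBool
| EFalse : forall Γ, tm Γ TBool
| EIf : forall Γ τ, tm Γ TBool -> tm Γ τ -> tm Γ τ -> tm Γ τ
| ELam : forall Γ τ τ', tm (τ :: Γ) τ' -> tm Γ (TArr τ τ')
| EApp : forall Γ τ τ', tm Γ (TArr τ τ') -> tm Γ τ -> tm Γ τ'
| ERec : forall Γ τ τ', tm (τ :: TArr τ τ' :: Γ) τ' -> tm Γ (TArr τ τ').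

Arguments EUnit {Γ}.
Arguments ETrue {Γ}.
Arguments EFalse {Γ}.

Fixpoint ctx_prod (T : ty -> cpo) (Γ : list ty) : cpo :=
  match Γ with
  | [] => cone
  | τ :: Γ' => cprod (ctx_prod T Γ') (T τ)
  end.

Fixpoint lookup (T : ty -> cpo) (Γ : list ty) (τ : ty) (x : var Γ τ) :
  ctx_prod T Γ ~> T τ :=
  match x in var Γ τ return ctx_prod T Γ ~> T τ with
  | @VZ _ Γ' τ => pi2 (ctx_prod T Γ') (T τ)
  | @VS _ Γ' τ σ y => lookup T y ∘ pi1 (ctx_prod T Γ') (T σ)
  end.

Fixpoint Vty (τ : ty) : cpo :=
  match τ with
  | TUnit => cone
  | TBool => ctwo
  | TProd τ1 τ2 => cprod (Vty τ1) (Vty τ2)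
  | TArr τ τ' => cexp (Vty τ) (lift (Vty τ'))
  end.

Definition Vctx (Γ : list ty) : cpo := ctx_prod Vty Γ.

Definition ev_dagger (X Y : cpo) : lift (cprod (cexp X (lift Y)) X) ~> lift Y :=
  dagger (ev X (lift Y)).

Fixpoint Vsem (Γ : list ty) (τ : ty) (e : tm Γ τ) : Vctx Γ ~> lift (Vty τ) :=
  match e in tm Γ τ return Vctx Γ ~> lift (Vty τ) with
  | @EVar Γ τ x => eta (Vty τ) ∘ lookup Vty x
  | @EUnit Γ => eta cone ∘ bang (Vctx Γ)
  | @EPair Γ τ1 τ2 e1 e2 => dpair (Vsem e1) (Vsem e2)
  | @EFst Γ τ1 τ2 e => lift_map (pi1 (Vty τ1) (Vty τ2)) ∘ Vsem e
  | @ESnd Γ τ1 τ2 e => lift_map (pi2 (Vty τ1) (Vty τ2)) ∘ Vsem e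
  | @ETrue Γ => eta ctwo ∘ @constc (Vctx Γ) ctwo true
  | @EFalse Γ => eta ctwo ∘ @constc (Vctx Γ) ctwo false
  | @EIf Γ τ e0 e1 e2 => @cond (Vctx Γ) (lift_alg (Vty τ)) (Vsem e0) (Vsem e1) (Vsem e2)
  | @ELam Γ τ τ' e => eta (Vty (TArr τ τ')) ∘ @curry (Vctx Γ) (Vty τ) (lift (Vty τ')) (Vsem e)
  | @EApp Γ τ τ' e e' => ev_dagger (Vty τ) (Vty τ') ∘ dpair (Vsem e) (Vsem e')
  | @ERec Γ τ τ' e =>
      eta (Vty (TArr τ τ'))
        ∘ (cfix (exp_alg (Vty τ) (lift_alg (Vty τ')))
             ∘ @curry (Vctx Γ) (Vty (TArr τ τ')) (Vty (TArr τ τ'))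
                 (@curry (cprod (Vctx Γ) (Vty (TArr τ τ'))) (Vty τ) (lift (Vty τ'))
                    (Vsem e)))
  end.

Fixpoint Nty (τ : ty) : alg :=
  match τ with
  | TUnit => lift_alg cone
  | TBool => lift_alg ctwo
  | TProd τ1 τ2 => prod_alg (Nty τ1) (Nty τ2)
  | TArr τ τ' => exp_alg (Nty τ) (Nty τ')
  end.

Definition Nctx (Γ : list ty) : cpo := ctx_prod (fun τ => alg_cpo (Nty τ)) Γ.

Fixpoint Nsem (Γ : list ty) (τ : ty) (e : tm Γ τ) : Nctx Γ ~> Nty τ :=
  match e in tm Γ τ return Nctx Γ ~> Nty τ with
  | @EVar Γ τ x => lookup (fun τ => alg_cpo (Nty τ)) x
  | @EUnit Γ => eta cone ∘ bang (Nctx Γ)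
  | @EPair Γ τ1 τ2 e1 e2 => pairc (Nsem e1) (Nsem e2)
  | @EFst Γ τ1 τ2 e => pi1 (Nty τ1) (Nty τ2) ∘ Nsem e
  | @ESnd Γ τ1 τ2 e => pi2 (Nty τ1) (Nty τ2) ∘ Nsem e
  | @ETrue Γ => eta ctwo ∘ @constc (Nctx Γ) ctwo true
  | @EFalse Γ => eta ctwo ∘ @constc (Nctx Γ) ctwo false
  | @EIf Γ τ e0 e1 e2 => @cond (Nctx Γ) (Nty τ) (Nsem e0) (Nsem e1) (Nsem e2)
  | @ELam Γ τ τ' e => @curry (Nctx Γ) (Nty τ) (Nty τ') (Nsem e)
  | @EApp Γ τ τ' e e' => ev (Nty τ) (Nty τ') ∘ pairc (Nsem e) (Nsem e')
  | @ERec Γ τ τ' e =>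
      cfix (Nty (TArr τ τ'))
        ∘ @curry (Nctx Γ) (Nty (TArr τ τ')) (Nty (TArr τ τ'))
            (@curry (cprod (Nctx Γ) (Nty (TArr τ τ'))) (Nty τ) (Nty τ') (Nsem e))
  end.

Fixpoint Rel (τ : ty) : forall W : cpo, (W ~> lift (Vty τ)) -> (W ~> Nty τ) -> Prop :=
  match τ return forall W : cpo, (W ~> lift (Vty τ)) -> (W ~> Nty τ) -> Prop with
  | TUnit => fun W (f_v f_n : W ~> lift cone) => forall w, f_v w ⊑ f_n w
  | TBool => fun W (f_v f_n : W ~> lift ctwo) => forall w, f_v w ⊑ f_n w
  | TProd τ1 τ2 => fun W f_v f_n =>
      @Rel τ1 W (lift_map (pi1 (Vty τ1) (Vty τ2)) ∘ f_v) (pi1 (Nty τ1) (Nty τ2) ∘ f_n)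
      /\ @Rel τ2 W (lift_map (pi2 (Vty τ1) (Vty τ2)) ∘ f_v) (pi2 (Nty τ1) (Nty τ2) ∘ f_n)
  | TArr τ τ' => fun W f_v f_n =>
      forall (W' : cpo) (w : W' ~> W) (g_v : W' ~> lift (Vty τ)) (g_n : W' ~> Nty τ),
        @Rel τ W' g_v g_n ->
        @Rel τ' W' (ev_dagger (Vty τ) (Vty τ') ∘ dpair (f_v ∘ w) g_v)
                   (ev (Nty τ) (Nty τ') ∘ pairc (f_n ∘ w) g_n)
  end.

Fixpoint dtuple (T : ty -> cpo) (W : cpo) (Γ : list ty) :
  (forall τ, var Γ τ -> W ~> lift (T τ)) -> W ~> lift (ctx_prod T Γ) :=
  match Γ return (forall τ, var Γ τ -> W ~> lift (T τ)) -> W ~> lift (ctx_prod T Γ) with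
  | [] => fun _ => eta cone ∘ bang W
  | τ :: Γ' => fun f => dpair (dtuple (fun σ x => f σ (VS x))) (f τ VZ)
  end.

Fixpoint tuple (T : ty -> cpo) (W : cpo) (Γ : list ty) :
  (forall τ, var Γ τ -> W ~> T τ) -> W ~> ctx_prod T Γ :=
  match Γ return (forall τ, var Γ τ -> W ~> T τ) -> W ~> ctx_prod T Γ with
  | [] => fun _ => bang W
  | τ :: Γ' => fun f => pairc (tuple (fun σ x => f σ (VS x))) (f τ VZ)
  end.

Definition related (Γ : list ty) (τ : ty)
  (g_v : Vctx Γ ~> lift (Vty τ)) (g_n : Nctx Γ ~> Nty τ) : Prop :=
  forall (W : cpo) (f_v : forall σ, var Γ σ -> W ~> lift (Vty σ))
         (f_n : forall σ, var Γ σ -> W ~> Nty σ),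
    (forall σ (x : var Γ σ), @Rel σ W (f_v σ x) (f_n σ x)) ->
    @Rel τ W (dagger g_v ∘ dtuple f_v)
             (g_n ∘ tuple (T := fun τ => alg_cpo (Nty τ)) f_n).

Infix "⋉" := related (at level 70, no associativity).

Inductive vty : Type :=
| VTUnit
| VTProd (A1 A2 : vty)
| VTBool
| VTU (C : cty)
with cty : Type :=
| CTProd (C1 C2 : cty)
| CTArr (A : vty) (C : cty)
| CTF (A : vty).

Inductive val : list vty -> vty -> Type :=
| VVar : forall Γ A, var Γ A -> val Γ A
| VUnit : forall Γ, val Γ VTUnit
| VPair : forall Γ A1 A2, val Γ A1 -> val Γ A2 -> val Γ (VTProd A1 A2)
| VTrue : forall Γ, val Γ VTBool
| VFalse : forall Γ, val Γ VTBool
| VThunk : forall Γ C, cmp Γ C -> val Γ (VTU C)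
with cmp : list vty -> cty -> Type :=
| CPair : forall Γ C1 C2, cmp Γ C1 -> cmp Γ C2 -> cmp Γ (CTProd C1 C2)
| CFst : forall Γ C1 C2, cmp Γ (CTProd C1 C2) -> cmp Γ C1
| CSnd : forall Γ C1 C2, cmp Γ (CTProd C1 C2) -> cmp Γ C2
| CLam : forall Γ A C, cmp (A :: Γ) C -> cmp Γ (CTArr A C)
| CApp : forall Γ A C, val Γ A -> cmp Γ (CTArr A C) -> cmp Γ C
| CReturn : forall Γ A, val Γ A -> cmp Γ (CTF A)
| CTo : forall Γ A C, cmp Γ (CTF A) -> cmp (A :: Γ) C -> cmp Γ C
(* [CMatch V M] binds [x1 : A1] first, so index 0 in [M] is [x2]. *)
| CMatch : forall Γ A1 A2 C,
    val Γ (VTProd A1 A2) -> cmp (A2 :: A1 :: Γ) C -> cmp Γ C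
| CIf : forall Γ C, val Γ VTBool -> cmp Γ C -> cmp Γ C -> cmp Γ C
| CForce : forall Γ C, val Γ (VTU C) -> cmp Γ C
| CRec : forall Γ C, cmp (VTU C :: Γ) C -> cmp Γ C.

Arguments VUnit {Γ}.
Arguments VTrue {Γ}.
Arguments VFalse {Γ}.

Definition ren (Γ Δ : list vty) : Type := forall A, var Γ A -> var Δ A.

Definition ren_up (Γ Δ : list vty) (B : vty) (r : ren Γ Δ) : ren (B :: Γ) (B :: Δ) :=
  fun A x =>
    match x in var Γ' A return
      match Γ' with
      | [] => unit
      | B :: Γ => ren Γ Δ -> var (B :: Δ) A
      end
    with
    | VZ => fun _ => VZ
    | VS y => fun r => VS (r _ y)
    end r.

Fixpoint val_ren (Γ Δ : list vty) (A : vty) (r : ren Γ Δ) (V : val Γ A) {struct V} :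
  val Δ A :=
  match V in val Γ A return ren Γ Δ -> val Δ A with
  | VVar x => fun r => VVar (r _ x)
  | VUnit => fun _ => VUnit
  | VPair V1 V2 => fun r => VPair (val_ren r V1) (val_ren r V2)
  | VTrue => fun _ => VTrue
  | VFalse => fun _ => VFalse
  | VThunk M => fun r => VThunk (cmp_ren r M)
  end r
with cmp_ren (Γ Δ : list vty) (C : cty) (r : ren Γ Δ) (M : cmp Γ C) {struct M} :
  cmp Δ C :=
  match M in cmp Γ C return ren Γ Δ -> cmp Δ C with
  | CPair M1 M2 => fun r => CPair (cmp_ren r M1) (cmp_ren r M2)
  | CFst M => fun r => CFst (cmp_ren r M)
  | CSnd M => fun r => CSnd (cmp_ren r M)
  | CLam M => fun r => CLam (cmp_ren (ren_up r) M)
  | CApp V M => fun r => CApp (val_ren r V) (cmp_ren r M)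
  | CReturn V => fun r => CReturn (val_ren r V)
  | CTo M N => fun r => CTo (cmp_ren r M) (cmp_ren (ren_up r) N)
  | CMatch V M => fun r => CMatch (val_ren r V) (cmp_ren (ren_up (ren_up r)) M)
  | CIf V M1 M2 => fun r => CIf (val_ren r V) (cmp_ren r M1) (cmp_ren r M2)
  | CForce V => fun r => CForce (val_ren r V)
  | CRec M => fun r => CRec (cmp_ren (ren_up r) M)
  end r.

Definition wk (Γ : list vty) (B : vty) : ren Γ (B :: Γ) := fun A x => VS x.

Definition sub (Γ Δ : list vty) : Type := forall A, var Γ A -> val Δ A.

Definition sub_id (Γ : list vty) : sub Γ Γ := fun A x => VVar x.

Definition sub_cons (Γ Δ : list vty) (B : vty) (V : val Δ B) (s : sub Γ Δ) :
  sub (B :: Γ) Δ :=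
  fun A x =>
    match x in var Γ' A return
      match Γ' with
      | [] => unit
      | B :: Γ => val Δ B -> sub Γ Δ -> val Δ A
      end
    with
    | VZ => fun V _ => V
    | VS y => fun _ s => s _ y
    end V s.

Definition sub_up (Γ Δ : list vty) (B : vty) (s : sub Γ Δ) : sub (B :: Γ) (B :: Δ) :=
  sub_cons (VVar VZ) (fun A x => val_ren (@wk Δ B) (s A x)).

Fixpoint val_sub (Γ Δ : list vty) (A : vty) (s : sub Γ Δ) (V : val Γ A) {struct V} :
  val Δ A :=
  match V in val Γ A return sub Γ Δ -> val Δ A with
  | VVar x => fun s => s _ x
  | VUnit => fun _ => VUnit
  | VPair V1 V2 => fun s => VPair (val_sub s V1) (val_sub s V2)
  | VTrue => fun _ => VTrue
  | VFalse => fun _ => VFalse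
  | VThunk M => fun s => VThunk (cmp_sub s M)
  end s
with cmp_sub (Γ Δ : list vty) (C : cty) (s : sub Γ Δ) (M : cmp Γ C) {struct M} :
  cmp Δ C :=
  match M in cmp Γ C return sub Γ Δ -> cmp Δ C with
  | CPair M1 M2 => fun s => CPair (cmp_sub s M1) (cmp_sub s M2)
  | CFst M => fun s => CFst (cmp_sub s M)
  | CSnd M => fun s => CSnd (cmp_sub s M)
  | CLam M => fun s => CLam (cmp_sub (sub_up s) M)
  | CApp V M => fun s => CApp (val_sub s V) (cmp_sub s M)
  | CReturn V => fun s => CReturn (val_sub s V)
  | CTo M N => fun s => CTo (cmp_sub s M) (cmp_sub (sub_up s) N)
  | CMatch V M => fun s => CMatch (val_sub s V) (cmp_sub (sub_up (sub_up s)) M)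
  | CIf V M1 M2 => fun s => CIf (val_sub s V) (cmp_sub s M1) (cmp_sub s M2)
  | CForce V => fun s => CForce (val_sub s V)
  | CRec M => fun s => CRec (cmp_sub (sub_up s) M)
  end s.

Definition subst1 (Γ : list vty) (A : vty) (C : cty) (V : val Γ A) (M : cmp (A :: Γ) C) :
  cmp Γ C :=
  cmp_sub (sub_cons V (@sub_id Γ)) M.

Definition subst2 (Γ : list vty) (A1 A2 : vty) (C : cty)
  (V1 : val Γ A1) (V2 : val Γ A2) (M : cmp (A2 :: A1 :: Γ) C) : cmp Γ C :=
  cmp_sub (sub_cons V2 (sub_cons V1 (@sub_id Γ))) M.

Inductive eval : forall C : cty, cmp [] C -> cmp [] C -> Prop :=
| eval_pair : forall C1 C2 (M1 : cmp [] C1) (M2 : cmp [] C2),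
    eval (CPair M1 M2) (CPair M1 M2)
| eval_lam : forall A C (M : cmp [A] C), eval (CLam M) (CLam M)
| eval_return : forall A (V : val [] A), eval (CReturn V) (CReturn V)
| eval_fst : forall C1 C2 (M : cmp [] (CTProd C1 C2)) N1 N2 R,
    eval M (CPair N1 N2) -> eval N1 R -> eval (CFst M) R
| eval_snd : forall C1 C2 (M : cmp [] (CTProd C1 C2)) N1 N2 R,
    eval M (CPair N1 N2) -> eval N2 R -> eval (CSnd M) R
| eval_app : forall A C (V : val [] A) (M : cmp [] (CTArr A C)) N R,
    eval M (CLam N) -> eval (subst1 V N) R -> eval (CApp V M) R
| eval_to : forall A C (M : cmp [] (CTF A)) (N : cmp [A] C) V R,
    eval M (CReturn V) -> eval (subst1 V N) R -> eval (CTo M N) R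
| eval_if_true : forall C (M1 M2 : cmp [] C) R,
    eval M1 R -> eval (CIf VTrue M1 M2) R
| eval_if_false : forall C (M1 M2 : cmp [] C) R,
    eval M2 R -> eval (CIf VFalse M1 M2) R
| eval_match : forall A1 A2 C (V1 : val [] A1) (V2 : val [] A2) (M : cmp [A2; A1] C) R,
    eval (subst2 V1 V2 M) R -> eval (CMatch (VPair V1 V2) M) R
| eval_force : forall C (M : cmp [] C) R, eval M R -> eval (CForce (VThunk M)) R
| eval_rec : forall C (M : cmp [VTU C] C) R,
    eval (subst1 (VThunk (CRec M)) M) R -> eval (CRec M) R.

Infix "⇓" := eval (at level 70, no associativity).

Fixpoint var_map (A B : Type) (f : A -> B) (Γ : list A) (a : A) (x : var Γ a) :
  var (map f Γ) (f a) :=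
  match x in var Γ a return var (map f Γ) (f a) with
  | VZ => VZ
  | VS y => VS (var_map f y)
  end.

Fixpoint cbv_ty (τ : ty) : vty :=
  match τ with
  | TUnit => VTUnit
  | TBool => VTBool
  | TProd τ1 τ2 => VTProd (cbv_ty τ1) (cbv_ty τ2)
  | TArr τ τ' => VTU (CTArr (cbv_ty τ) (CTF (cbv_ty τ')))
  end.

Definition cbv_ctx (Γ : list ty) : list vty := map cbv_ty Γ.

(* The sequencing and conditional below are placed under auxiliary binders,
   hence the weakenings. *)
Fixpoint cbv (Γ : list ty) (τ : ty) (e : tm Γ τ) : cmp (cbv_ctx Γ) (CTF (cbv_ty τ)) :=
  match e in tm Γ τ return cmp (cbv_ctx Γ) (CTF (cbv_ty τ)) with
  | EVar x => CReturn (VVar (var_map cbv_ty x))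
  | EUnit => CReturn VUnit
  | EPair e1 e2 =>
      CTo (cbv e1)
        (CTo (cmp_ren (@wk _ _) (cbv e2))
           (CReturn (VPair (VVar (VS VZ)) (VVar VZ))))
  | EFst e => CTo (cbv e) (CMatch (VVar VZ) (CReturn (VVar (VS VZ))))
  | ESnd e => CTo (cbv e) (CMatch (VVar VZ) (CReturn (VVar VZ)))
  | ETrue => CReturn VTrue
  | EFalse => CReturn VFalse
  | EIf e0 e1 e2 =>
      CTo (cbv e0)
        (CIf (VVar VZ) (cmp_ren (@wk _ _) (cbv e1)) (cmp_ren (@wk _ _) (cbv e2)))
  | ELam e => CReturn (VThunk (CLam (cbv e)))
  | EApp e e' =>
      CTo (cbv e)
        (CTo (cmp_ren (@wk _ _) (cbv e'))
           (CApp (VVar VZ) (CForce (VVar (VS VZ)))))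
  | ERec e => CReturn (VThunk (CRec (CLam (cbv e))))
  end.

Fixpoint cbn_ty (τ : ty) : cty :=
  match τ with
  | TUnit => CTF VTUnit
  | TBool => CTF VTBool
  | TProd τ1 τ2 => CTProd (cbn_ty τ1) (cbn_ty τ2)
  | TArr τ τ' => CTArr (VTU (cbn_ty τ)) (cbn_ty τ')
  end.

Definition cbn_ctx (Γ : list ty) : list vty := map (fun τ => VTU (cbn_ty τ)) Γ.

Fixpoint cbn (Γ : list ty) (τ : ty) (e : tm Γ τ) : cmp (cbn_ctx Γ) (cbn_ty τ) :=
  match e in tm Γ τ return cmp (cbn_ctx Γ) (cbn_ty τ) with
  | EVar x => CForce (VVar (var_map (fun τ => VTU (cbn_ty τ)) x))
  | EUnit => CReturn VUnit
  | EPair e1 e2 => CPair (cbn e1) (cbn e2)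
  | EFst e => CFst (cbn e)
  | ESnd e => CSnd (cbn e)
  | ETrue => CReturn VTrue
  | EFalse => CReturn VFalse
  | EIf e0 e1 e2 =>
      CTo (cbn e0)
        (CIf (VVar VZ) (cmp_ren (@wk _ _) (cbn e1)) (cmp_ren (@wk _ _) (cbn e2)))
  | ELam e => CLam (cbn e)
  | EApp e e' => CApp (VThunk (cbn e')) (cbn e)
  | ERec e => CRec (CLam (cbn e))
  end.

(* Main.v *)
(* For [Vsem e ⋉ Nsem e], the relations [Rel] are closed under decreasing
   the call-by-value side and increasing the call-by-name side, under reindexing
   along [W' ~> W], under conditionals with related guards, and under pointwise
   lubs of chains on the call-by-value side.  The
   last closure, applied to Kleene iterates with the call-by-name side kept at
   its least fixed point, handles recursion.

   Evaluation is compared operationally, without going through the model: a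
   logical relation between closed values of type [cbv_ty τ] and closed
   computations of type [cbn_ty τ] is indexed by a budget of [CRec] unfoldings,
   so that a recursive function is related to its call-by-name counterpart by
   induction on the budget.  It is closed under replacing the call-by-name
   computation by one with more results, which absorbs the administrative
   reductions of the translations. *)
Require Import Defs.
From Stdlib Require Import List Arith Lia FunctionalExtensionality ProofIrrelevance.
Import ListNotations.

Set Implicit Arguments.
Unset Strict Implicit.
Unset Printing Implicit Defensive.

(** * Closure properties of the semantic relation *)

(** At arrows the argument stays fixed, so monotonicity of application in the function suffices. The
    lemma also stands in for rewriting: maps that agree pointwise are exchanged through
    [le_refl]. *)
Lemma Rel_mono τ (W : cpo) (f f' : W ~> lift (Vty τ)) (g g' : W ~> Nty τ) :
  (forall w, f' w ⊑ f w) -> (forall w, g w ⊑ g' w) ->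
  Rel (τ := τ) f g -> Rel (τ := τ) f' g'.
Proof.
  revert W f f' g g'; induction τ as [| |τ1 IH1 τ2 IH2|τ IH τ' IH'];
    intros W f f' g g' Hf Hg.
  1,2: intros H w; eapply le_trans; [apply Hf|]; eapply le_trans; [apply H|apply Hg].
  - intros [H1 H2]; split; [eapply IH1; [..|exact H1] | eapply IH2; [..|exact H2]];
      intros w; try apply (Hg w); apply (fn_mono (lift_map _)), Hf.
  - intros H W' w a_v a_n Ha; eapply IH'; [..|apply (H W' w a_v a_n Ha)].
    + intros x; apply (fn_mono (ev_dagger _ _ ∘ seqL _ _)); split;
        [apply Hf|apply le_refl].
    + intros x; apply Hg.
Qed.

Lemma Rel_comp τ (W W' : cpo) (f : W ~> lift (Vty τ)) (g : W ~> Nty τ) (w : W' ~> W) :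
  Rel (τ := τ) f g -> Rel (τ := τ) (f ∘ w) (g ∘ w).
Proof.
  revert W W' f g w; induction τ as [| |τ1 IH1 τ2 IH2|τ IH τ' IH']; intros W W' f g w.
  1,2: intros H x; apply (H (w x)).
  - intros [H1 H2]; split;
      [eapply Rel_mono; [..|eapply IH1, H1] | eapply Rel_mono; [..|eapply IH2, H2]];
      intros x; apply le_refl.
  - intros H W'' w' a_v a_n Ha.
    eapply Rel_mono; [..|apply (H W'' (w ∘ w') a_v a_n Ha)]; intros x; apply le_refl.
Qed.

(** Conditionals commute with projection and application, which brings the claim down to ground
    types. There an undefined [h_v] yields bottom, and a defined one forces the same boolean on
    [h_n], since [ctwo] is discrete. *)
Lemma Rel_cond τ (W : cpo) (h_v h_n : W ~> lift ctwo)
    (f_v g_v : W ~> lift_alg (Vty τ)) (f_n g_n : W ~> Nty τ) :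
  (forall w, h_v w ⊑ h_n w) -> Rel (τ := τ) f_v f_n -> Rel (τ := τ) g_v g_n ->
  Rel (τ := τ) (cond h_v f_v g_v) (cond h_n f_n g_n).
Proof.
  revert W h_v h_n f_v g_v f_n g_n; induction τ as [| |τ1 IH1 τ2 IH2|τ IH τ' IH'];
    intros W h_v h_n f_v g_v f_n g_n Hh.
  1,2: intros Hf Hg w; specialize (Hh w); simpl in *; unfold cond_fn;
    destruct (h_v w) as [b|]; [|exact I];
    destruct (h_n w) as [b'|]; [|destruct Hh];
    simpl in Hh; subst b'; destruct b; [apply Hf|apply Hg].
  - intros [Hf1 Hf2] [Hg1 Hg2]; split;
      [eapply Rel_mono; [..|exact (IH1 W h_v h_n _ _ _ _ Hh Hf1 Hg1)]
      |eapply Rel_mono; [..|exact (IH2 W h_v h_n _ _ _ _ Hh Hf2 Hg2)]];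
      intros w; simpl; unfold cond_fn;
      try destruct (h_v w) as [[|]|]; try destruct (h_n w) as [[|]|];
      apply (@le_refl (lift _)) || apply le_refl.
  - intros Hf Hg W' w a_v a_n Ha.
    eapply Rel_mono;
      [..|exact (IH' W' (h_v ∘ w) (h_n ∘ w) _ _ _ _ (fun x => Hh (w x))
                   (Hf W' w a_v a_n Ha) (Hg W' w a_v a_n Ha))];
      intros x; simpl; unfold cond_fn.
    + destruct (h_v (w x)) as [[|]|]; apply (@le_refl (lift _)).
    + destruct (h_n (w x)) as [[|]|]; apply le_refl.
Qed.

(** Projection and application are continuous on the call-by-value side, so the lub passes to the
    component types. *)
Lemma Rel_lub τ (W : cpo) (c : nat -> (W ~> lift (Vty τ))) (f : W ~> lift (Vty τ))
    (g : W ~> Nty τ) :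
  (forall w, chain (fun n => c n w)) -> (forall w, lub_of (fun n => c n w) (f w)) ->
  (forall n, Rel (τ := τ) (c n) g) -> Rel (τ := τ) f g.
Proof.
  revert W c f g; induction τ as [| |τ1 IH1 τ2 IH2|τ IH τ' IH']; intros W c f g Hc Hf.
  1,2: intros H w; apply (Hf w); intros n; apply H.
  - intros H; split;
      [eapply IH1; [..|intros n; exact (proj1 (H n))]
      |eapply IH2; [..|intros n; exact (proj2 (H n))]]; intros w;
      try (intros n; apply (fn_mono (lift_map _)), (Hc w n));
      apply (fn_lub (lift_map _) (Hc w) (Hf w)).
  - intros H W' w a_v a_n Ha.
    eapply IH'; [..|intros n; exact (H n W' w a_v a_n Ha)]; intros x.
    + intros n; apply (fn_mono (ev_dagger _ _ ∘ seqL _ _)); split; [apply Hc|apply le_refl].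
    (* Continuity is applied to the chain of pairs whose second component is constant. *)
    + apply (fn_lub (ev_dagger (Vty τ) (Vty τ') ∘ seqL _ _)
               (c := fun n => (c n (w x), a_v x)) (x := (f (w x), a_v x))).
      * intros n; split; [apply Hc|apply le_refl].
      * apply prod_lub; split; [apply Hf|apply (lub_const (a_v x))].
Qed.

Lemma Rel_bot τ (W : cpo) (f : W ~> lift (Vty τ)) (g : W ~> Nty τ) :
  (forall w, f w = None) -> Rel (τ := τ) f g.
Proof.
  revert W f g; induction τ as [| |τ1 IH1 τ2 IH2|τ IH τ' IH']; intros W f g H.
  1,2: intros w; rewrite H; exact I.
  - split; [apply IH1|apply IH2]; intros w; simpl; rewrite H; reflexivity.
  - intros W' w a_v a_n _; apply IH'; intros x; simpl; rewrite H; reflexivity.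
Qed.

(** * Environments, abstraction and recursion in the model *)

Definition fam_cons (T : ty -> cpo) (W : cpo) (Γ : list ty) (τ : ty)
    (f : forall σ, var Γ σ -> W ~> T σ) (g : W ~> T τ) σ (x : var (τ :: Γ) σ) : W ~> T σ :=
  match x in var Γ' σ return
    match Γ' with
    | [] => unit
    | τ :: Γ => (forall σ, var Γ σ -> W ~> T σ) -> (W ~> T τ) -> W ~> T σ
    end
  with
  | VZ => fun _ g => g
  | VS y => fun f _ => f _ y
  end f g.

(** The match motive is trivial on the empty context and quantifies over [P] on a nonempty one, so
    no axiom about equality of indices is needed. *)
Lemma var_cons_inv (A : Type) (Γ : list A) b (P : forall a, var (b :: Γ) a -> Prop) :
  P b VZ -> (forall a (y : var Γ a), P a (VS y)) -> forall a x, P a x.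
Proof.
  intros HZ HS a x; revert P HZ HS.
  refine (match x in var Γ' a return
    match Γ' return var Γ' a -> Prop with
    | [] => fun _ => True
    | b :: Γ => fun x => forall P : forall a, var (b :: Γ) a -> Prop,
        P b VZ -> (forall a (y : var Γ a), P a (VS y)) -> P a x
    end x with VZ => _ | VS y => _ end); auto.
Qed.

(** Strict tupling is defined only where every entry is. The converse fails: one entry may be
    defined while another diverges, so the variable case of the fundamental lemma has only an
    inequality. *)
Lemma lookup_dtuple (T : ty -> cpo) (W : cpo) Γ τ (x : var Γ τ)
    (f : forall σ, var Γ σ -> W ~> lift (T σ)) w ρ :
  dtuple f w = Some ρ -> f τ x w = Some (lookup T x ρ).
Proof.
  induction x as [Γ τ|Γ τ σ x IH]; simpl;
    destruct (dtuple (fun σ x => f σ (VS x)) w) as [ρ'|] eqn:E; simpl; try discriminate;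
    destruct (f _ VZ w) as [a|] eqn:Ea; simpl; try discriminate;
    injection 1 as <-; simpl; [reflexivity|].
  apply (IH (fun σ x => f σ (VS x))), E.
Qed.

Lemma lookup_tuple (T : ty -> cpo) (W : cpo) Γ τ (x : var Γ τ)
    (f : forall σ, var Γ σ -> W ~> T σ) w :
  lookup T x (tuple f w) = f τ x w.
Proof.
  induction x as [Γ τ|Γ τ σ x IH]; simpl; [reflexivity|].
  apply (IH (fun σ x => f σ (VS x))).
Qed.

(** The hypothesis is used at the world [W'] of the argument, with the environment reindexed along
    [w] and extended by that argument. *)
Lemma related_lam Γ τ τ' (g_v : Vctx (τ :: Γ) ~> lift (Vty τ')) (g_n : Nctx (τ :: Γ) ~> Nty τ') :
  related (τ := τ') g_v g_n ->
  related (τ := TArr τ τ') (eta (Vty (TArr τ τ')) ∘ curry (W := Vctx Γ) g_v)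
    (curry (W := Nctx Γ) g_n).
Proof.
  intros H W f_v f_n Hf W' w a_v a_n Ha.
  eapply Rel_mono;
    [..|apply (H W' (fam_cons (T := fun σ => lift (Vty σ)) (fun σ x => f_v σ x ∘ w) a_v)
                    (fam_cons (T := fun σ => Nty σ) (fun σ x => f_n σ x ∘ w) a_n))].
  - intros x; simpl; unfold Vctx.
    (* Tupling commutes with reindexing, by induction on the context. *)
    replace (dtuple (fun σ x => f_v σ x ∘ w) x) with (dtuple f_v (w x)).
    + destruct (dtuple f_v (w x)); simpl; [|exact I].
      destruct (a_v x); simpl; exact I || apply (@le_refl (lift _)).
    + clear; induction Γ as [|σ Γ IH]; simpl; [reflexivity|].
      f_equal; apply IH.
  - intros x; simpl.
    replace (tuple (fun σ x => f_n σ x ∘ w) x) with (tuple f_n (w x)); [apply le_refl|].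
    clear; induction Γ as [|σ Γ IH]; simpl; [reflexivity|].
    f_equal; apply IH.
  - apply var_cons_inv; [exact Ha|]. intros σ x; apply Rel_comp, Hf.
Qed.

(* The [n]th approximant is undefined where [ρ] is, and the [n]th Kleene iterate elsewhere. *)
Fixpoint rec_approx (W Γ : cpo) (X Y : cpo) (g : cprod (cprod Γ (cexp X (lift Y))) X ~> lift Y)
    (ρ : W ~> lift Γ) (n : nat) : W ~> lift (cexp X (lift Y)) :=
  match n with
  | 0 => dagger (eta (cexp X (lift Y)) ∘ constc Γ (bot (a := exp_alg X (lift_alg Y)))) ∘ ρ
  | S n => dagger (eta (cexp X (lift Y)) ∘ curry g) ∘ dpair ρ (rec_approx g ρ n)
  end.

Lemma rec_approxE (W Γ : cpo) (X Y : cpo) (g : cprod (cprod Γ (cexp X (lift Y))) X ~> lift Y)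
    (ρ : W ~> lift Γ) n w :
  rec_approx g ρ n w =
    match ρ w with
    | None => None
    | Some γ => Some (iter (Z := exp_alg X (lift_alg Y)) (curry (curry g) γ) n)
    end.
Proof.
  induction n as [|n IH]; simpl; [|rewrite IH]; destruct (ρ w); reflexivity.
Qed.

Lemma rec_approx_lub (W Γ : cpo) (X Y : cpo) (g : cprod (cprod Γ (cexp X (lift Y))) X ~> lift Y)
    (ρ : W ~> lift Γ) w :
  chain (fun n => rec_approx g ρ n w) /\
  lub_of (fun n => rec_approx g ρ n w)
    ((dagger (eta (cexp X (lift Y))
         ∘ (cfix (exp_alg X (lift_alg Y)) ∘ curry (curry g))) ∘ ρ) w).
Proof.
  set (Z := exp_alg X (lift_alg Y)).
  replace (fun n => rec_approx g ρ n w) with (fun n =>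
     match ρ w with
     | None => None
     | Some γ => Some (iter (Z := Z) (curry (curry g) γ) n)
     end) by (apply functional_extensionality; intros n; symmetry; apply rec_approxE).
  simpl; destruct (ρ w) as [γ|].
  - set (F := curry (curry g) γ : Z ~> Z).
    split; [exact (iter_chain F)|].
    apply (fn_lub (eta Z) (iter_chain F) (fix_lub F)).
  - split; [intros n; exact I|apply (@lub_const (lift Z))].
Qed.

(** Every approximant is related to the full call-by-name fixed point, and [Rel_lub] passes to the
    limit. A successor approximant is an instance of [related_lam] whose environment holds the
    previous one. *)
Lemma related_rec Γ τ τ' (g_v : Vctx (τ :: TArr τ τ' :: Γ) ~> lift (Vty τ'))
    (g_n : Nctx (τ :: TArr τ τ' :: Γ) ~> Nty τ') :
  related (τ := τ') g_v g_n ->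
  related (τ := TArr τ τ')
    (eta (Vty (TArr τ τ'))
       ∘ (cfix (exp_alg (Vty τ) (lift_alg (Vty τ')))
            ∘ curry (W := Vctx Γ) (X := Vty (TArr τ τ')) (Y := Vty (TArr τ τ'))
                (curry (W := cprod (Vctx Γ) (Vty (TArr τ τ'))) g_v)))
    (cfix (Nty (TArr τ τ'))
       ∘ curry (W := Nctx Γ) (X := Nty (TArr τ τ')) (Y := Nty (TArr τ τ'))
           (curry (W := cprod (Nctx Γ) (Nty (TArr τ τ'))) g_n)).
Proof.
  intros H W f_v f_n Hf.
  apply Rel_lub with (c := rec_approx (Γ := Vctx Γ) g_v (dtuple f_v));
    [intros w; apply rec_approx_lub..|].
  match goal with |- forall n, Rel _ ?r => set (r_n := r) end.
  intros n; induction n as [|n IH].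
  (* The zeroth approximant is [Some] of the bottom function where the environment is defined, not
     [None]; [Rel_bot] therefore applies only after application to an argument. *)
  - intros W' w a_v a_n Ha.
    apply Rel_bot; intros x; simpl; unfold Vctx.
    destruct (dtuple f_v (w x)), (a_v x); reflexivity.
  - eapply Rel_mono; [..|apply (related_lam H)
        with (f_v := fam_cons (T := fun σ => lift (Vty σ)) f_v
                       (rec_approx (Γ := Vctx Γ) g_v (dtuple f_v) n : W ~> lift (Vty (TArr τ τ'))))
             (f_n := fam_cons (T := fun σ => Nty σ) f_n (r_n : W ~> Nty (TArr τ τ')));
      apply var_cons_inv; [exact IH|exact Hf]].
    + intros w; apply (@le_refl (lift _)).
    (* One unfolding of the call-by-name fixed point gives it back. *)
    + intros w.
      exact (eq_ind_r (fun y => y ⊑ r_n w) (le_refl (r_n w))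
               (proj1 (fix_lfp (Z := Nty (TArr τ τ')) _))).
Qed.

(** * Fundamental lemma of the model *)

Lemma Vsem_related_Nsem Γ τ (e : tm Γ τ) : Vsem e ⋉ Nsem e.
Proof.
  induction e as [Γ τ x|Γ|Γ τ1 τ2 e1 IH1 e2 IH2|Γ τ1 τ2 e IH|Γ τ1 τ2 e IH|Γ|Γ
    |Γ τ e0 IH0 e1 IH1 e2 IH2|Γ τ τ' e IH|Γ τ τ' e IH e' IH'|Γ τ τ' e IH];
    [..|apply related_rec, IH]; [..|apply related_lam, IH|]; intros W f_v f_n Hf.
  - eapply Rel_mono; [..|apply (Hf _ x)]; intros w; simpl; unfold Vctx, Nctx.
    + destruct (dtuple f_v w) as [ρ|] eqn:E; [|exact I].
      rewrite (lookup_dtuple x E); apply (@le_refl (lift _)).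
    + exact (eq_ind_r (fun y => f_n τ x w ⊑ y) (le_refl _) (lookup_tuple x f_n w)).
  - intros w; simpl; unfold Vctx; destruct (dtuple f_v w); simpl; reflexivity || exact I.
  (* Projecting a strict pair may diverge because of the other component, so it only lies below the
     chosen one. *)
  - split;
      [eapply Rel_mono; [..|apply (IH1 W f_v f_n Hf)]
      |eapply Rel_mono; [..|apply (IH2 W f_v f_n Hf)]];
      intros w; simpl; unfold Vctx; try apply le_refl;
      destruct (dtuple f_v w) as [ρ|]; simpl; fold (Vctx Γ); try exact I;
      destruct (Vsem e1 ρ), (Vsem e2 ρ); simpl; exact I || apply le_refl.
  - eapply Rel_mono; [..|apply (proj1 (IH W f_v f_n Hf))]; intros w; [|apply le_refl].
    simpl; unfold Vctx; destruct (dtuple f_v w) as [ρ|]; [apply (@le_refl (lift _))|exact I].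
  - eapply Rel_mono; [..|apply (proj2 (IH W f_v f_n Hf))]; intros w; [|apply le_refl].
    simpl; unfold Vctx; destruct (dtuple f_v w) as [ρ|]; [apply (@le_refl (lift _))|exact I].
  - intros w; simpl; unfold Vctx; destruct (dtuple f_v w); simpl; reflexivity || exact I.
  - intros w; simpl; unfold Vctx; destruct (dtuple f_v w); simpl; reflexivity || exact I.
  - eapply Rel_mono; [..|exact (Rel_cond (IH0 W f_v f_n Hf) (IH1 W f_v f_n Hf) (IH2 W f_v f_n Hf))];
      intros w; [|apply le_refl].
    simpl; unfold cond_fn, Vctx; simpl.
    destruct (dtuple f_v w) as [ρ|]; [apply (@le_refl (lift _))|exact I].
  - eapply Rel_mono;
      [..|exact (IH W f_v f_n Hf W (idc W) _ _ (IH' W f_v f_n Hf))];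
      intros w; [|apply le_refl].
    simpl; unfold Vctx; destruct (dtuple f_v w) as [ρ|]; [apply (@le_refl (lift _))|exact I].
Qed.

(* Substitution calculus *)
Scheme val_mind := Induction for val Sort Prop
  with cmp_mind := Induction for cmp Sort Prop.
Combined Scheme val_cmp_ind from val_mind, cmp_mind.

Lemma sub_id_eq :
  (forall Γ A (V : val Γ A) (s : sub Γ Γ), (forall B x, s B x = VVar x) -> val_sub s V = V) /\
  (forall Γ C (M : cmp Γ C) (s : sub Γ Γ), (forall B x, s B x = VVar x) -> cmp_sub s M = M).
Proof.
  assert (U : forall Γ B (s : sub Γ Γ), (forall A x, s A x = VVar x) ->
    forall A x, sub_up (B := B) s x = VVar (A := A) x).
  { intros Γ B s H; apply var_cons_inv; [reflexivity|]; intros A x; simpl.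
    rewrite H; reflexivity. }
  apply val_cmp_ind; intros; simpl; f_equal; auto.
Qed.

(** The composite is any [t] agreeing pointwise, here and below, so that passing a binder needs only
    the pointwise fact [U] and no equality of functions. *)
Lemma ren_ren_eq :
  (forall Γ A (V : val Γ A) Δ Θ (r : ren Γ Δ) (r' : ren Δ Θ) (t : ren Γ Θ),
     (forall B x, r' B (r B x) = t B x) -> val_ren r' (val_ren r V) = val_ren t V) /\
  (forall Γ C (M : cmp Γ C) Δ Θ (r : ren Γ Δ) (r' : ren Δ Θ) (t : ren Γ Θ),
     (forall B x, r' B (r B x) = t B x) -> cmp_ren r' (cmp_ren r M) = cmp_ren t M).
Proof.
  assert (U : forall Γ Δ Θ B (r : ren Γ Δ) (r' : ren Δ Θ) (t : ren Γ Θ),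
    (forall A x, r' A (r A x) = t A x) ->
    forall A x, ren_up r' (ren_up r x) = ren_up (B := B) t (A := A) x).
  { intros Γ Δ Θ B r r' t H; apply var_cons_inv; [reflexivity|]; intros A x; simpl.
    rewrite H; reflexivity. }
  apply val_cmp_ind; intros; simpl; f_equal; auto.
Qed.

Lemma sub_ren_eq :
  (forall Γ A (V : val Γ A) Δ Θ (r : ren Γ Δ) (s : sub Δ Θ) (t : sub Γ Θ),
     (forall B x, s B (r B x) = t B x) -> val_sub s (val_ren r V) = val_sub t V) /\
  (forall Γ C (M : cmp Γ C) Δ Θ (r : ren Γ Δ) (s : sub Δ Θ) (t : sub Γ Θ),
     (forall B x, s B (r B x) = t B x) -> cmp_sub s (cmp_ren r M) = cmp_sub t M).
Proof.
  assert (U : forall Γ Δ Θ B (r : ren Γ Δ) (s : sub Δ Θ) (t : sub Γ Θ),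
    (forall A x, s A (r A x) = t A x) ->
    forall A x, sub_up s (ren_up r x) = sub_up (B := B) t (A := A) x).
  { intros Γ Δ Θ B r s t H; apply var_cons_inv; [reflexivity|]; intros A x; simpl.
    rewrite H; reflexivity. }
  apply val_cmp_ind; intros; simpl; f_equal; auto.
Qed.

Lemma ren_sub_eq :
  (forall Γ A (V : val Γ A) Δ Θ (s : sub Γ Δ) (r : ren Δ Θ) (t : sub Γ Θ),
     (forall B x, val_ren r (s B x) = t B x) -> val_ren r (val_sub s V) = val_sub t V) /\
  (forall Γ C (M : cmp Γ C) Δ Θ (s : sub Γ Δ) (r : ren Δ Θ) (t : sub Γ Θ),
     (forall B x, val_ren r (s B x) = t B x) -> cmp_ren r (cmp_sub s M) = cmp_sub t M).
Proof.
  assert (U : forall Γ Δ Θ B (s : sub Γ Δ) (r : ren Δ Θ) (t : sub Γ Θ),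
    (forall A x, val_ren r (s A x) = t A x) ->
    forall A x, val_ren (ren_up r) (sub_up s x) = sub_up (B := B) t (A := A) x).
  { intros Γ Δ Θ B s r t H; apply var_cons_inv; [reflexivity|]; intros A x; simpl.
    rewrite <- H, (proj1 ren_ren_eq _ _ _ _ _ _ _ (fun A x => VS (r A x))) by reflexivity.
    symmetry; apply ren_ren_eq; reflexivity. }
  apply val_cmp_ind; intros; simpl; f_equal; auto.
Qed.

Lemma sub_sub_eq :
  (forall Γ A (V : val Γ A) Δ Θ (s : sub Γ Δ) (s' : sub Δ Θ) (t : sub Γ Θ),
     (forall B x, val_sub s' (s B x) = t B x) -> val_sub s' (val_sub s V) = val_sub t V) /\
  (forall Γ C (M : cmp Γ C) Δ Θ (s : sub Γ Δ) (s' : sub Δ Θ) (t : sub Γ Θ),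
     (forall B x, val_sub s' (s B x) = t B x) -> cmp_sub s' (cmp_sub s M) = cmp_sub t M).
Proof.
  assert (U : forall Γ Δ Θ B (s : sub Γ Δ) (s' : sub Δ Θ) (t : sub Γ Θ),
    (forall A x, val_sub s' (s A x) = t A x) ->
    forall A x, val_sub (sub_up s') (sub_up s x) = sub_up (B := B) t (A := A) x).
  { intros Γ Δ Θ B s s' t H; apply var_cons_inv; [reflexivity|]; intros A x; simpl.
    (* Both sides equal one substitution into [s A x], namely [s'] followed by weakening. *)
    rewrite <- H,
      (proj1 sub_ren_eq _ _ _ _ _ _ _ (fun A x => val_ren (@wk Θ B) (s' A x)))
      by reflexivity.
    symmetry; apply ren_sub_eq; reflexivity. }
  apply val_cmp_ind; intros; simpl; f_equal; auto.
Qed.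

(** Turns a reduction under a closing substitution into an extension of that substitution, the form
    in which the logical relation handles environments. *)
Lemma subst1_sub_up Γ Δ B C (s : sub Γ Δ) (V : val Δ B) (M : cmp (B :: Γ) C) :
  subst1 V (cmp_sub (sub_up s) M) = cmp_sub (sub_cons V s) M.
Proof.
  apply sub_sub_eq, var_cons_inv; [reflexivity|]; intros A x; simpl.
  rewrite (proj1 sub_ren_eq _ _ _ _ _ _ _ (@sub_id Δ)) by reflexivity.
  apply sub_id_eq; reflexivity.
Qed.

Lemma sub_cons_wk Γ Δ B C (s : sub Γ Δ) (V : val Δ B) (M : cmp Γ C) :
  cmp_sub (sub_cons V s) (cmp_ren (@wk Γ B) M) = cmp_sub s M.
Proof. apply sub_ren_eq; reflexivity. Qed.

(** * Evaluation with counted unfoldings *)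

(* The index counts the unfoldings of [CRec]. *)
Inductive evaln : nat -> forall C : cty, cmp [] C -> cmp [] C -> Prop :=
| evaln_pair : forall C1 C2 (M1 : cmp [] C1) (M2 : cmp [] C2),
    evaln 0 (CPair M1 M2) (CPair M1 M2)
| evaln_lam : forall A C (M : cmp [A] C), evaln 0 (CLam M) (CLam M)
| evaln_return : forall A (V : val [] A), evaln 0 (CReturn V) (CReturn V)
| evaln_fst : forall n m C1 C2 (M : cmp [] (CTProd C1 C2)) N1 N2 R,
    evaln n M (CPair N1 N2) -> evaln m N1 R -> evaln (n + m) (CFst M) R
| evaln_snd : forall n m C1 C2 (M : cmp [] (CTProd C1 C2)) N1 N2 R,
    evaln n M (CPair N1 N2) -> evaln m N2 R -> evaln (n + m) (CSnd M) R
| evaln_app : forall n m A C (V : val [] A) (M : cmp [] (CTArr A C)) N R,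
    evaln n M (CLam N) -> evaln m (subst1 V N) R -> evaln (n + m) (CApp V M) R
| evaln_to : forall n m A C (M : cmp [] (CTF A)) (N : cmp [A] C) V R,
    evaln n M (CReturn V) -> evaln m (subst1 V N) R -> evaln (n + m) (CTo M N) R
| evaln_if_true : forall n C (M1 M2 : cmp [] C) R,
    evaln n M1 R -> evaln n (CIf VTrue M1 M2) R
| evaln_if_false : forall n C (M1 M2 : cmp [] C) R,
    evaln n M2 R -> evaln n (CIf VFalse M1 M2) R
| evaln_match : forall n A1 A2 C (V1 : val [] A1) (V2 : val [] A2) (M : cmp [A2; A1] C) R,
    evaln n (subst2 V1 V2 M) R -> evaln n (CMatch (VPair V1 V2) M) R
| evaln_force : forall n C (M : cmp [] C) R, evaln n M R -> evaln n (CForce (VThunk M)) R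
| evaln_rec : forall n C (M : cmp [VTU C] C) R,
    evaln n (subst1 (VThunk (CRec M)) M) R -> evaln (S n) (CRec M) R.

Lemma eval_evaln C (M R : cmp [] C) : eval M R -> exists n, evaln n M R.
Proof.
  induction 1;
    repeat match goal with H : exists _, _ |- _ => destruct H end;
    eexists; econstructor; eassumption.
Qed.

Ltac inv H :=
  inversion H; clear H; subst;
  repeat match goal with
  | E : existT _ _ _ = existT _ _ _ |- _ => apply inj_pair2 in E; subst
  end.

Lemma evaln_return_inv n A (V W : val [] A) :
  evaln n (CReturn V) (CReturn W) -> n = 0 /\ V = W.
Proof. intros E; inv E; auto. Qed.

Lemma evaln_lam_inv n A C (M N : cmp [A] C) :
  evaln n (CLam M) (CLam N) -> n = 0 /\ M = N.
Proof. intros E; inv E; auto. Qed.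

Lemma evaln_app_inv n A C (V : val [] A) (M : cmp [] (CTArr A C)) R :
  evaln n (CApp V M) R ->
  exists i j N, n = i + j /\ evaln i M (CLam N) /\ evaln j (subst1 V N) R.
Proof. intros E; inv E; eauto 6. Qed.

Lemma evaln_to_inv n Γ A C (s : sub Γ []) (M : cmp Γ (CTF A)) (N : cmp (A :: Γ) C) R :
  evaln n (cmp_sub s (CTo M N)) R ->
  exists i j V, n = i + j /\ evaln i (cmp_sub s M) (CReturn V)
    /\ evaln j (cmp_sub (sub_cons V s) N) R.
Proof.
  intros E; inv E; do 3 eexists; split; [reflexivity|]; split; [eassumption|].
  rewrite <- subst1_sub_up; assumption.
Qed.

Lemma eval_to_sub Γ A C (s : sub Γ []) (M : cmp Γ (CTF A)) (N : cmp (A :: Γ) C) V R :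
  eval (cmp_sub s M) (CReturn V) -> eval (cmp_sub (sub_cons V s) N) R ->
  eval (cmp_sub s (CTo M N)) R.
Proof.
  intros EM EN; simpl; eapply eval_to; [exact EM|]; rewrite subst1_sub_up; exact EN.
Qed.

Lemma evaln_match_inv n A1 A2 C (V1 : val [] A1) (V2 : val [] A2) (M : cmp [A2; A1] C) R :
  evaln n (CMatch (VPair V1 V2) M) R -> evaln n (subst2 V1 V2 M) R.
Proof. intros E; inv E; assumption. Qed.

Lemma evaln_force_inv n C (M R : cmp [] C) : evaln n (CForce (VThunk M)) R -> evaln n M R.
Proof. intros E; inv E; assumption. Qed.

Lemma evaln_rec_inv n C (M : cmp [VTU C] C) R :
  evaln n (CRec M) R -> exists i, n = S i /\ evaln i (subst1 (VThunk (CRec M)) M) R.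
Proof. intros E; inv E; eauto. Qed.

(** * The operational logical relation *)

Definition approx C (M N : cmp [] C) : Prop := forall R, eval M R -> eval N R.

(** A step-indexed relation with budget [k]. At arrows the application spends [n] unfoldings and
    leaves [j - n]; ranging over all [j <= k] builds in downward closure. Canonical forms at [TBool]
    let the conditional reduce, and products observe [M] only through its projections. *)
Fixpoint VR (τ : ty) : nat -> val [] (cbv_ty τ) -> cmp [] (cbn_ty τ) -> Prop :=
  match τ return nat -> val [] (cbv_ty τ) -> cmp [] (cbn_ty τ) -> Prop with
  | TUnit => fun k V M => eval M (CReturn V)
  | TBool => fun k V M => (V = VTrue \/ V = VFalse) /\ eval M (CReturn V)
  | TProd τ1 τ2 => fun k V M => exists V1 V2,
      V = VPair V1 V2 /\ VR k V1 (CFst M) /\ VR k V2 (CSnd M)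
  | TArr τ τ' => fun k V M => forall j V' M' n R,
      j <= k -> VR (τ := τ) j V' M' ->
      evaln n (CApp V' (CForce V)) (CReturn R) -> n <= j ->
      VR (j - n) R (CApp (VThunk M') M)
  end.

Definition ER τ k (M : cmp [] (CTF (cbv_ty τ))) (N : cmp [] (cbn_ty τ)) : Prop :=
  forall n V, evaln n M (CReturn V) -> n <= k -> VR (k - n) V N.

Lemma VR_le τ k j V (M : cmp [] (cbn_ty τ)) : j <= k -> VR k V M -> VR j V M.
Proof.
  revert k j; induction τ as [| |τ1 IH1 τ2 IH2|τ IH τ' IH']; intros k j L; simpl; auto.
  - intros (V1 & V2 & -> & H1 & H2); exists V1, V2; eauto.
  - intros H i V' M' n R Li; apply H; lia.
Qed.

(** Projections and application evaluate their computation first, so they preserve [approx]. *)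
Lemma VR_approx τ k V (M N : cmp [] (cbn_ty τ)) : approx M N -> VR k V M -> VR k V N.
Proof.
  revert k; induction τ as [| |τ1 IH1 τ2 IH2|τ IH τ' IH']; intros k L; simpl.
  - apply L.
  - intros [H1 H2]; split; [exact H1|apply L, H2].
  - intros (V1 & V2 & -> & H1 & H2); exists V1, V2; split; [reflexivity|].
    split; [eapply IH1, H1|eapply IH2, H2]; intros R E; inv E; econstructor; eauto.
  - intros H j V' M' n R Lj HV E Ln; eapply IH'; [|eapply H; eassumption].
    intros R' E'; inv E'; econstructor; eauto.
Qed.

(** Call-by-name variables stand for thunks, hence the [CForce], which is also how [cbn] translates
    a variable. *)
Definition env_rel Γ k (s_v : sub (cbv_ctx Γ) []) (s_n : sub (cbn_ctx Γ) []) : Prop :=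
  forall τ (x : var Γ τ),
    VR k (s_v _ (var_map cbv_ty x)) (CForce (s_n _ (var_map (fun τ => VTU (cbn_ty τ)) x))).

Lemma env_rel_cons Γ τ k s_v s_n V (M : cmp [] (cbn_ty τ)) :
  env_rel (Γ := Γ) k s_v s_n -> VR k V M ->
  env_rel (Γ := τ :: Γ) k (sub_cons V s_v) (sub_cons (VThunk M) s_n).
Proof.
  intros Hs HV; unfold env_rel; apply var_cons_inv; [|exact Hs].
  eapply VR_approx, HV; intros R E; constructor; exact E.
Qed.

Lemma env_rel_le Γ k j s_v s_n :
  j <= k -> env_rel (Γ := Γ) k s_v s_n -> env_rel (Γ := Γ) j s_v s_n.
Proof. intros L H τ x; eapply VR_le, H; exact L. Qed.

Definition ER_open Γ τ (M : cmp (cbv_ctx Γ) (CTF (cbv_ty τ))) (N : cmp (cbn_ctx Γ) (cbn_ty τ)) :=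
  forall k s_v s_n, env_rel k s_v s_n -> ER k (cmp_sub s_v M) (cmp_sub s_n N).

(** Forcing a thunked abstraction unfolds nothing, so the body keeps the whole budget [j], to which
    the environment is lowered. *)
Lemma VR_lam Γ τ τ' (e : tm (τ :: Γ) τ') k s_v s_n :
  ER_open (cbv e) (cbn e) -> env_rel (Γ := Γ) k s_v s_n ->
  VR (τ := TArr τ τ') k (VThunk (CLam (cmp_sub (sub_up s_v) (cbv e))))
    (CLam (cmp_sub (sub_up s_n) (cbn e))).
Proof.
  intros IH Hs j V M n R Lj HV E Ln.
  apply evaln_app_inv in E as (i1 & i2 & N & -> & E1 & E2).
  apply evaln_force_inv, evaln_lam_inv in E1 as [-> <-].
  rewrite subst1_sub_up in E2.
  eapply VR_approx; [|apply (IH _ _ _ (env_rel_cons (env_rel_le Lj Hs) HV) _ _ E2 Ln)].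
  intros R' E; econstructor; [constructor|]; rewrite subst1_sub_up; exact E.
Qed.

(** Each use of the function first unfolds [CRec], which costs one unit; the recursive occurrence is
    thus needed only at the smaller budget. At budget 0 no application can complete. *)
Lemma VR_rec Γ τ τ' (e : tm (τ :: TArr τ τ' :: Γ) τ') k s_v s_n :
  ER_open (cbv e) (cbn e) -> env_rel (Γ := Γ) k s_v s_n ->
  VR (τ := TArr τ τ') k (VThunk (cmp_sub s_v (CRec (CLam (cbv e)))))
    (cmp_sub s_n (CRec (CLam (cbn e)))).
Proof.
  intros IH; induction k as [|k IHk]; intros Hs j V M n R Lj HV E Ln;
    apply evaln_app_inv in E as (i1 & i2 & N & -> & E1 & E2);
    apply evaln_force_inv, evaln_rec_inv in E1 as (i & -> & E1); [lia|].
  assert (HF := IHk (env_rel_le (Nat.le_succ_diag_r k) Hs)).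
  assert (HL := VR_lam IH (env_rel_cons (env_rel_le (Nat.le_succ_diag_r k) Hs) HF)).
  change (evaln i (subst1 (VThunk (cmp_sub s_v (CRec (CLam (cbv e)))))
                     (cmp_sub (sub_up s_v) (CLam (cbv e)))) (CLam N)) in E1.
  rewrite subst1_sub_up in E1.
  (* The unit spent on unfolding leaves [j - 1] for the remaining [i + i2] unfoldings. *)
  replace (j - (S i + i2)) with (j - 1 - (i + i2)) by lia.
  eapply VR_approx; [|apply (HL (j - 1) V M)]; [|lia|apply (VR_le (k := j)); [lia|exact HV]
    | |lia].
  - intros R' E; inv E; econstructor; [|eassumption].
    apply (eval_rec (M := cmp_sub (sub_up s_n) (CLam (cbn e)))).
    rewrite subst1_sub_up; eassumption.
  - econstructor; [constructor; exact E1|exact E2].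
Qed.

Lemma cbv_cbn_related Γ τ (e : tm Γ τ) : ER_open (cbv e) (cbn e).
Proof.
  induction e as [Γ τ x|Γ|Γ τ1 τ2 e1 IH1 e2 IH2|Γ τ1 τ2 e IH|Γ τ1 τ2 e IH|Γ|Γ
    |Γ τ e0 IH0 e1 IH1 e2 IH2|Γ τ τ' e IH|Γ τ τ' e IH e' IH'|Γ τ τ' e IH];
    intros k s_v s_n Hs n V E Ln;
    (* A translation of the form [CReturn] costs nothing; every other one starts with a
       sequencing. *)
    (apply evaln_return_inv in E as [-> <-]; rewrite Nat.sub_0_r)
    || apply evaln_to_inv in E as (i & m & V0 & -> & E0 & E).
  - apply Hs.
  - simpl; constructor.
  - apply evaln_to_inv in E as (j & l & V1 & -> & E1 & E).
    rewrite sub_cons_wk in E1; apply evaln_return_inv in E as [-> <-]; simpl.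
    exists V0, V1; split; [reflexivity|]; split.
    (* Each component has the budget left by its own evaluation, lowered to what remains after
       both. *)
    + eapply VR_approx; [|apply VR_le with (k := k - i), (IH1 k s_v s_n Hs); [lia|exact E0|lia]].
      intros R E; econstructor; [constructor|exact E].
    + eapply VR_approx; [|apply VR_le with (k := k - j), (IH2 k s_v s_n Hs); [lia|exact E1|lia]].
      intros R E; econstructor; [constructor|exact E].
  - destruct (IH k s_v s_n Hs _ _ E0) as (V1 & V2 & -> & H1 & H2); [lia|].
    simpl in E.
    apply evaln_match_inv, evaln_return_inv in E as [-> <-].
    rewrite Nat.add_0_r; exact H1.
  - destruct (IH k s_v s_n Hs _ _ E0) as (V1 & V2 & -> & H1 & H2); [lia|].
    simpl in E.
    apply evaln_match_inv, evaln_return_inv in E as [-> <-].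
    rewrite Nat.add_0_r; exact H2.
  - simpl; split; [auto|constructor].
  - simpl; split; [auto|constructor].
  - simpl in E; rewrite !sub_cons_wk in E.
    destruct (IH0 k s_v s_n Hs _ _ E0) as [[-> | ->] H0]; [lia|..]; inv E.
    + eapply VR_approx; [|apply VR_le with (k := k - m), (IH1 k s_v s_n Hs); [lia|eassumption|lia]].
      intros R E; eapply eval_to_sub; [exact H0|]; simpl.
      rewrite !sub_cons_wk; constructor; exact E.
    + eapply VR_approx; [|apply VR_le with (k := k - m), (IH2 k s_v s_n Hs); [lia|eassumption|lia]].
      intros R E; eapply eval_to_sub; [exact H0|]; simpl.
      rewrite !sub_cons_wk; constructor; exact E.
  - apply VR_lam; assumption.
  - apply evaln_to_inv in E as (j & l & V1 & -> & E1 & E).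
    rewrite sub_cons_wk in E1.
    (* The function is related at [k - i]; it is applied at [k - i - j], the budget left after the
       argument, and the call spends [l] more. *)
    replace (k - (i + (j + l))) with (k - i - j - l) by lia.
    apply (IH k s_v s_n Hs _ _ E0) with (V' := V1); [lia|lia| |exact E|lia].
    apply VR_le with (k := k - j), (IH' k s_v s_n Hs); [lia|exact E1|lia].
  - apply VR_rec; assumption.
Qed.

(** At [TBool] the relation contains the call-by-name evaluation at whatever budget remains, so the
    budget is exactly the number [n] of unfoldings. Identity substitutions give [e] the open form,
    and the empty environment is vacuously related. *)
Lemma cbv_cbn_return (e : tm [] TBool) (V : val [] VTBool) :
  cbv e ⇓ CReturn V -> cbn e ⇓ CReturn V.
Proof.
  intros E; apply eval_evaln in E as [n E].
  rewrite <- (proj2 sub_id_eq _ _ (cbv e) (@sub_id []) (fun _ _ => eq_refl)) in E.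
  rewrite <- (proj2 sub_id_eq _ _ (cbn e) (@sub_id []) (fun _ _ => eq_refl)).
  refine (proj2 (cbv_cbn_related (e := e) (k := n) _ E (le_n n))).
  intros τ x; inversion x.
Qed.

Theorem corollary4p11 :
  (forall (Γ : list ty) (τ : ty) (e : tm Γ τ), Vsem e ⋉ Nsem e) /\
  (forall (e' : tm [] TBool) (V : val [] VTBool),
      cbv e' ⇓ CReturn V -> cbn e' ⇓ CReturn V).
Proof. exact (conj Vsem_related_Nsem cbv_cbn_return). Qed.
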